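(* Consider the state-observation model $(X_t,Y_t)$, the exact posterior $\pi_t$, the metric $d$, the objective $J_{\eta,\nu}$, the optimality gap $\epsilon$ and the training procedure described in the context. Let $w>0$ be an integer window size, let $\mu$ be a probability distribution on $\mathbb{R}^n$, and let $(\hat f^\mu_{w,0},\hat T^\mu_{w,0})$ be the (random) output of the training procedure. Suppose that the following hold. (1) (Stationarity) The stochastic process $(X_t,Y_t)$ is stationary. In particular the model is time invariant, i.e. $a_t=a$ and $h_t=h$ for all $t=1,2,\ldots$, and $\pi_0$ is equal to the unique stationary distribution of $\mathcal A$, i.e. $\mathcal A\pi_0=\pi_0$. The stationary distribution has finite second moments and admits a density with respect to the Lebesgue measure. (2) (Uniform geometric filter stability) There exist $\lambda\in(0,1)$ and a constant $C>0$ such that for all (possibly random) probability measures $\rho,\rho'$ on $\mathbb{R}^n$ and all $t>s\ge 0$, $$d\big(F_{t,s}(Y_{t,s})(\rho),F_{t,s}(Y_{t,s})(\rho')\big)\le C\lambda^{t-s}d(\rho,\rho').$$ (3) (a) $\mu$ is equal to the stationary distribution of $X_t$; (b) there exists $M>0$ such that $d(\pi_t,\mu)<M$ for all $t$; (c) for some $\alpha>0$, the function $x\mapsto \frac12\|x\|^2-\hat f^\mu_{w,0}(x,y)$ is $\alpha$-strongly convex in $x$ for all $y$. Then, for all $t>w$, $$d\big(\hat T^\mu_{w,0}(\cdot,Y_{t,t-w})_{\#}\mu,\ \pi_t\big)\ \le\ C\lambda^w M+\sqrt{\frac{4}{\alpha}\,\mathbb{E}\,\epsilon(\hat f^\mu_{w,0},\hat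 T^\mu_{w,0})},$$ where the expectation on the right-hand side is with respect to the randomness of the training data and possibly of the optimization procedure.
   Context: **Model.** For $t=1,2,\ldots$, $X_t\sim a_t(\cdot\mid X_{t-1})$ with $X_0\sim\pi_0$, and $Y_t\sim h_t(\cdot\mid X_t)$, where $X_t\in\mathbb{R}^n$ is a hidden Markov state, $Y_t\in\mathbb{R}^m$ is the observation, $a_t(x'\mid x)$ is the transition kernel from $X_{t-1}=x$ to $X_t=x'$, and $h_t(y\mid x)$ is the likelihood of observing $Y_t=y$ given $X_t=x$. For $t>s\ge 0$ write $y_{t,s}:=\{y_t,\ldots,y_{s+1}\}$ and $Y_{t,s}:=\{Y_t,\ldots,Y_{s+1}\}$; in particular $Y_{t,t-w}=\{Y_t,\ldots,Y_{t-w+1}\}$. **Filter operators.** For a probability distribution $\pi$ on $\mathbb{R}^n$, define $$\mathcal A_t(\pi):=\int_{\mathbb{R}^n}a_t(\cdot\mid x)\pi(x)\,dx,\qquad \mathcal B_t(y)(\pi):=\frac{h_t(y\mid\cdot)\pi(\cdot)}{\int_{\mathbb{R}^n}h_t(y\mid x)\pi(x)\,dx},$$ $F_t(y):=\mathcal B_t(y)\circ\mathcal A_t$, and $F_{t,s}(y_{t,s}):=F_t(y_t)\circ F_{t-1}(y_{t-1})\circ\cdots\circ F_{s+1}(y_{s+1})$ for $t>s$. In the time-invariant case, write $\mathcal A=\mathcal A_t$. **Exact posterior.** $\pi_t(\cdot):=\mathbb{P}(X_t\in\cdot\mid Y_{t,0})=F_{t,0}(Y_{t,0})(\pi_0)$,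 a random probability measure. **Metric.** For (possibly random) probability measures $\rho,\rho'$ on $\mathbb{R}^n$, $$d(\rho,\rho'):=\sup_{g\in\mathcal G}\sqrt{\mathbb{E}\Big|\int g\,d\rho-\int g\,d\rho'\Big|^2},$$ where the expectation is over all the randomness of $\rho$ and $\rho'$, and $\mathcal G:=\{g:\mathbb{R}^n\to\mathbb{R}:\ |g(x)|\le 1,\ |g(x)-g(x')|\le\|x-x'\|\ \ \forall x,x'\}$. **Objective and optimality gap.** Let $\nu$ be the joint law of $(X_w,Y_{w,0})$ generated by the model with $X_0\sim\mu$, let $\nu_Y$ be the law of $Y_{w,0}$ under $\nu$, and let $\eta:=\mu\otimes\nu_Y$ (independent coupling). For $f:\mathbb{R}^n\times\mathbb{R}^{mw}\to\mathbb{R}$ and $T:\mathbb{R}^n\times\mathbb{R}^{mw}\to\mathbb{R}^n$, set $$J_{\eta,\nu}(f,T):=\mathbb{E}_{(X,Y)\sim\nu}[f(X,Y)]+\mathbb{E}_{(X,Y)\sim\eta}\Big[\tfrac12\|T(X,Y)-X\|^2-f(T(X,Y),Y)\Big].$$ The max-min problem is $\max_{f}\min_{T}J_{\eta,\nu}(f,T)$, where $f$ ranges over $c\text{-Concave}_x$, i.e. functions such that $x\mapsto\frac12\|x\|^2-f(x,y)$ is convex for all $y$, and $T$ ranges over the set $\mathcal M(\eta)$ of $\eta$-measurable maps. The optimality gap of a pair $(\hat f,\hat T)$ is $$\epsilon(\hat f,\hat T):=J_{\eta,\nu}(\hat f,\hat T)-\min_{T}J_{\eta,\nu}(\hat f,T)+\max_{f}\min_{T}J_{\eta,\nu}(f,T)-\min_{T}J_{\eta,\nu}(\hat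 f,T),$$ with the same ranges for $f$ and $T$ (and $\eta,\nu$ the exact distributions above, not their empirical approximations). **Training procedure.** The training data are $J$ independent realizations $\{X_0^j,(X_1^j,Y_1^j),\ldots,(X_w^j,Y_w^j)\}_{j=1}^J$ of the model with $X^j_0\sim\mu$, independent of the process $(X_t,Y_t)$ being filtered. With $\sigma$ a random permutation of $\{1,\ldots,J\}$, set $\hat\nu:=\frac1J\sum_{j=1}^J\delta_{(X_w^j,Y_{w,0}^j)}$ and $\hat\eta:=\frac1J\sum_{j=1}^J\delta_{(X_0^{\sigma_j},Y_{w,0}^j)}$. The pair $(\hat f^\mu_{w,0},\hat T^\mu_{w,0})$ is the output of a (possibly randomized) optimization procedure that approximately solves $\max_{f\in\mathcal F}\min_{T\in\mathcal T}J_{\hat\eta,\hat\nu}(f,T)$ over parametric classes $\mathcal F$ and $\mathcal T$ of functions and maps; here $J_{\hat\eta,\hat\nu}$ is defined as $J_{\eta,\nu}$ with $\hat\eta,\hat\nu$ in place of $\eta,\nu$. The pair is therefore random, depending only on the training data and the randomness of the procedure, and is independent of the process $(X_t,Y_t)$ being filtered. No accuracy of the procedure is assumed; its accuracy enters only via $\epsilon$. **Push-forward.** $S_{\#}\mu$ denotes the push-forward of $\mu$ by the map $S$. *)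

(* Defs.v *)
From HB Require Import structures.
From mathcomp Require Import all_boot all_order all_algebra.
From mathcomp Require Import all_classical all_reals all_analysis.
From mathcomp Require Import measurable_realfun.

Set Implicit Arguments.
Unset Strict Implicit.
Unset Printing Implicit Defensive.

Import Order.TTheory GRing.Theory Num.Theory.
Import numFieldNormedType.Exports.

Local Open Scope classical_set_scope.
Local Open Scope ring_scope.

Definition rV_display : measure_display.
Proof. exact: default_measure_display. Qed.

(* The sigma-algebra generated by the coordinates, i.e. the Borel one. *)
Section rV_measurable.
Context {R : realType} (n : nat).

Let coord : 'I_n -> 'rV[R]_n -> R := fun i x => x ord0 i.

Let rV_set0 : g_sigma_preimage coord set0.
Proof. exact: sigma_algebra0. Qed.

Let rV_setC A : g_sigma_preimage coord A -> g_sigma_preimage coord (~` A).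
Proof. exact: sigma_algebraC. Qed.

Let rV_bigcup (F : (set 'rV[R]_n)^nat) :
  (forall i, g_sigma_preimage coord (F i)) ->
  g_sigma_preimage coord (\bigcup_i (F i)).
Proof. exact: sigma_algebra_bigcup. Qed.

HB.instance Definition _ := @isMeasurable.Build rV_display
  'rV[R]_n (g_sigma_preimage coord) rV_set0 rV_setC rV_bigcup.

Lemma measurable_rV_coord (i : 'I_n) :
  measurable_fun [set: 'rV[R]_n] (fun x : 'rV[R]_n => x ord0 i).
Proof.
move=> _ Y mY; rewrite setTI; apply: sub_sigma_algebra => /=.
rewrite -bigcup_seq/=; exists i => /=; first by rewrite mem_index_enum.
by exists Y => //; rewrite setTI.
Qed.

Lemma measurable_fun_rV d (T : measurableType d) (f : T -> 'rV[R]_n) :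
  (forall i, measurable_fun [set: T] (fun t => f t ord0 i)) ->
  measurable_fun [set: T] f.
Proof.
move=> mf _ A mA; rewrite setTI.
pose G : set (set 'rV[R]_n) := [set B | measurable (f @^-1` B)].
suff : G A by [].
apply: (smallest_sub _ _ mA) => [|B].
  split=> [|B GB|F GF]; rewrite /G/=.
  - by rewrite preimage_set0.
  - by rewrite setTD preimage_setC; exact: measurableC.
  - by rewrite preimage_bigcup; exact: bigcupT_measurable.
rewrite -bigcup_seq/= => -[i _ [C mC <-]].
by rewrite /G/= setTI; have := mf i measurableT C mC; rewrite setTI.
Qed.

End rV_measurable.

Section lebesgue_rV.
Context {R : realType}.

Definition rV_cons n (p : R * 'rV[R]_n) : 'rV[R]_n.+1 :=
  \row_i (if unlift ord0 i is Some j then p.2 ord0 j else p.1).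

Definition rV_uncons n (x : 'rV[R]_n.+1) : R * 'rV[R]_n :=
  (x ord0 ord0, \row_i x ord0 (lift ord0 i)).

Lemma rV_cons0 n (p : R * 'rV[R]_n) : rV_cons p ord0 ord0 = p.1.
Proof. by rewrite mxE unlift_none. Qed.

Lemma rV_consS n (p : R * 'rV[R]_n) i : rV_cons p ord0 (lift ord0 i) = p.2 ord0 i.
Proof. by rewrite mxE liftK. Qed.

Lemma rV_consK n : cancel (@rV_cons n) (@rV_uncons n).
Proof.
move=> p; rewrite /rV_uncons rV_cons0 [RHS]surjective_pairing; congr pair.
by apply/rowP => i; rewrite mxE rV_consS.
Qed.

Lemma measurable_rV_cons n : measurable_fun [set: R * 'rV[R]_n] (@rV_cons n).
Proof.
apply: measurable_fun_rV => i.
case: (unliftP ord0 i) => [j|] ->; last first.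
  by under eq_fun do rewrite rV_cons0; exact: measurable_fst.
under eq_fun do rewrite rV_consS.
exact: (measurableT_comp (measurable_rV_coord j) measurable_snd).
Qed.

Lemma measurable_rV_uncons n : measurable_fun [set: 'rV[R]_n.+1] (@rV_uncons n).
Proof.
apply/measurable_fun_pair; first exact: measurable_rV_coord.
apply: measurable_fun_rV => i.
by under eq_fun do rewrite mxE; exact: measurable_rV_coord.
Qed.

Section step.
Context n (leb : {sigma_finite_measure set 'rV[R]_n -> \bar R}).

Definition lebesgue_cons :=
  pushforward (@lebesgue_measure R \x leb)%E (@rV_cons n).

Let lebesgue_cons0 : lebesgue_cons set0 = 0%E.
Proof. by rewrite /lebesgue_cons /pushforward preimage_set0 measure0. Qed.

Let lebesgue_cons_ge0 A : (0 <= lebesgue_cons A)%E.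
Proof. by rewrite /lebesgue_cons /pushforward measure_ge0. Qed.

Let lebesgue_cons_sigma_additive : semi_sigma_additive lebesgue_cons.
Proof.
move=> F mF tF mUF; rewrite /lebesgue_cons /pushforward preimage_bigcup.
have mcons A : measurable A -> measurable (@rV_cons n @^-1` A).
  by move=> mA; rewrite -[X in measurable X]setTI; exact: measurable_rV_cons.
apply: measure_semi_sigma_additive => [k||]; first exact: mcons.
- apply/trivIsetP => i j _ _ ij; rewrite -preimage_setI.
  by move/trivIsetP : tF => ->//; rewrite preimage_set0.
- by rewrite -preimage_bigcup; exact: mcons.
Qed.

HB.instance Definition _ := isMeasure.Build _ _ _ lebesgue_cons
  lebesgue_cons0 lebesgue_cons_ge0 lebesgue_cons_sigma_additive.

Let lebesgue_cons_sigma_finite : sigma_finite setT lebesgue_cons.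
Proof.
have /sigma_finiteP[F [FT ndF Foo]] := sigma_finiteT (@lebesgue_measure R).
have /sigma_finiteP[G [GT ndG Goo]] := sigma_finiteT leb.
exists (fun k => @rV_uncons n @^-1` (F k `*` G k)).
  rewrite -preimage_bigcup (_ : \bigcup_k (F k `*` G k) = setT)//.
  rewrite -subTset => -[x y] _.
  have [i _ Fi] : (\bigcup_k F k) x by rewrite -FT.
  have [j _ Gj] : (\bigcup_k G k) y by rewrite -GT.
  exists (maxn i j) => //; split => /=.
  - by move: x Fi; exact/subsetPset/ndF/leq_maxl.
  - by move: y Gj; exact/subsetPset/ndG/leq_maxr.
move=> k; have [mF Fk] := Foo k; have [mG Gk] := Goo k.
have mFG : measurable (F k `*` G k) by exact: measurableX.
split; first by rewrite -[X in measurable X]setTI; exact: measurable_rV_uncons.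
rewrite /lebesgue_cons /pushforward -comp_preimage.
rewrite (_ : _ \o _ = id); last by apply/funext => p; exact: rV_consK.
rewrite preimage_id product_measure1E//.
by rewrite lte_mul_pinfty// ge0_fin_numE.
Qed.

HB.instance Definition _ := Measure_isSigmaFinite.Build _ _ _ lebesgue_cons
  lebesgue_cons_sigma_finite.

End step.

Fixpoint lebesgue_rV n : {sigma_finite_measure set 'rV[R]_n -> \bar R} :=
  if n is k.+1 then lebesgue_cons (lebesgue_rV k) else \d_(0 : 'rV[R]_0).

End lebesgue_rV.

Section euclid.
Context {R : realType} {n : nat}.
Implicit Types x y : 'rV[R]_n.

(* The norm `|x| of the library is the max norm. *)
Definition enorm x : R := Num.sqrt (\sum_(i < n) x ord0 i ^+ 2).

Definition strongly_convex (alpha : R) (phi : 'rV[R]_n -> R) : Prop :=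
  forall (x y : 'rV[R]_n) (t : R), 0 <= t <= 1 ->
    phi (t *: x + (1 - t) *: y) <=
    t * phi x + (1 - t) * phi y
      - alpha / 2 * t * (1 - t) * enorm (x - y) ^+ 2.

Definition bounded_lipschitz : set ('rV[R]_n -> R) :=
  [set g | (forall x, `|g x| <= 1) /\
           (forall x y, `|g x - g y| <= enorm (x - y))].

End euclid.

(* A random probability measure on R^n is a map rho : Omega -> probability,
   measurable for the sigma-algebra of [pprobability]; [metric] is stated for
   families of set functions so that push-forwards can be plugged in as such. *)
Section random_measures.
Context d (Omega : measurableType d) {R : realType} {n : nat}.

Definition random_probability (rho : Omega -> probability 'rV[R]_n R) : Prop :=
  measurable_fun [set: Omega] (rho : Omega -> pprobability 'rV[R]_n R).

Definition metric (P : probability Omega R)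
    (rho rho' : Omega -> set 'rV[R]_n -> \bar R) : \bar R :=
  ereal_sup [set sqrte (\int[P]_o
      (`|fine (\int[rho o]_x (g x)%:E) - fine (\int[rho' o]_x (g x)%:E)|
         ^+ 2)%:E)%E
    | g in bounded_lipschitz].

Definition independent_rv d1 d2 (T1 : measurableType d1)
    (T2 : measurableType d2) (P : probability Omega R)
    (U : Omega -> T1) (V : Omega -> T2) : Prop :=
  forall A B, measurable A -> measurable B ->
    P (U @^-1` A `&` V @^-1` B) = (P (U @^-1` A) * P (V @^-1` B))%E.

Definition mutually_independent_rv d1 (T1 : measurableType d1) (J : nat)
    (P : probability Omega R) (U : 'I_J -> Omega -> T1) : Prop :=
  forall A : 'I_J -> set T1, (forall j, measurable (A j)) ->
    P (\bigcap_(j in [set: 'I_J]) (U j @^-1` A j)) =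
    (\prod_(j < J) P (U j @^-1` A j))%E.

End random_measures.

(* [lik t y x] stands for h_t(y | x), a density in y with respect to the
   reference measure kappa on R^m (typically Lebesgue). The kernels are indexed
   by t = 1, 2, ...; the value at t = 0 is irrelevant. *)
Record ssm (R : realType) (n m : nat)
    (kappa : {sigma_finite_measure set 'rV[R]_m -> \bar R}) := Ssm {
  trans : nat -> R.-pker 'rV[R]_n ~> 'rV[R]_n ;
  lik : nat -> 'rV[R]_m -> 'rV[R]_n -> R ;
  lik_ge0 : forall t y x, 0 <= lik t y x ;
  measurable_lik : forall t, measurable_fun
    [set: 'rV[R]_m * 'rV[R]_n] (fun p => lik t p.1 p.2) ;
  lik_mass : forall t x, (\int[kappa]_y (lik t y x)%:E)%E = 1%E }.

Section filter.
Context {R : realType} {n m : nat}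
  {kappa : {sigma_finite_measure set 'rV[R]_m -> \bar R}}.
Variable mdl : ssm n kappa.
Local Open Scope ereal_scope.

Section predict.
Variables (t : nat) (pi : probability 'rV[R]_n R).

Definition predict (A : set 'rV[R]_n) : \bar R := \int[pi]_x trans mdl t x A.

Let predict0 : predict set0 = 0.
Proof. by rewrite /predict integral0_eq. Qed.

Let predict_ge0 A : 0 <= predict A.
Proof. exact: integral_ge0. Qed.

Let predict_sigma_additive : semi_sigma_additive predict.
Proof.
move=> U mU tU mUU; rewrite [X in _ --> X](_ : _ =
  \int[pi]_x (\sum_(k <oo) trans mdl t x (U k))); last first.
  by apply: eq_integral => x _; exact/esym/cvg_lim/measure_semi_sigma_additive.
apply/cvg_closeP; split.
  by apply: is_cvg_nneseries => k _ _; exact: integral_ge0.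
rewrite closeE// integral_nneseries// => k.
exact: measurable_kernel.
Qed.

HB.instance Definition _ := isMeasure.Build _ _ _ predict
  predict0 predict_ge0 predict_sigma_additive.

Let predict_setT : predict setT = 1.
Proof.
rewrite /predict (eq_integral (cst 1)); last by move=> x _; exact: prob_kernel.
by rewrite integral_cst// mul1e; exact: probability_setT.
Qed.

HB.instance Definition _ :=
  Measure_isProbability.Build _ _ _ predict predict_setT.

End predict.

Section bayes.
Variables (t : nat) (y : 'rV[R]_m) (pi : probability 'rV[R]_n R).

Definition reweigh (A : set 'rV[R]_n) : \bar R :=
  \int[pi]_(x in A) (lik mdl t y x)%:E.

Let reweigh0 : reweigh set0 = 0.
Proof. by rewrite /reweigh integral_set0. Qed.

Let reweigh_ge0 A : 0 <= reweigh A.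
Proof. by apply: integral_ge0 => x _; rewrite lee_fin lik_ge0. Qed.

Let reweigh_sigma_additive : semi_sigma_additive reweigh.
Proof.
apply: semi_sigma_additive_nng_induced => [|x]; last by rewrite lee_fin lik_ge0.
apply/measurable_EFinP.
exact: (measurableT_comp (measurable_lik mdl t) (measurable_pair1 y)).
Qed.

HB.instance Definition _ := isMeasure.Build _ _ _ reweigh
  reweigh0 reweigh_ge0 reweigh_sigma_additive.

Definition evidence : \bar R := \int[pi]_x (lik mdl t y x)%:E.

(* The normalization is meaningful only when 0 < evidence < +oo; [mnormalize]
   returns pi otherwise. *)
Definition bayes : probability 'rV[R]_n R := mnormalize reweigh pi.

End bayes.

Definition filter_step t (y : 'rV[R]_m) (pi : probability 'rV[R]_n R)
  : probability 'rV[R]_n R := bayes t y (predict t pi).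

Fixpoint filter_iter (y : nat -> 'rV[R]_m) (s k : nat)
    (pi : probability 'rV[R]_n R) : probability 'rV[R]_n R :=
  if k is k'.+1 then
    filter_step (s + k'.+1) (y (s + k'.+1)%N) (filter_iter y s k' pi)
  else pi.

(* F_{t,s}(y_{t,s}), where y is the whole observation sequence, of which only
   y_{s+1}, ..., y_t are used. *)
Definition filter_from_to (y : nat -> 'rV[R]_m) (s t : nat) :
    probability 'rV[R]_n R -> probability 'rV[R]_n R :=
  filter_iter y s (t - s).

(* Every normalization in F_{t,s}(y_{t,s})(pi) is meaningful. *)
Definition filter_defined (y : nat -> 'rV[R]_m) (s t : nat)
    (pi : probability 'rV[R]_n R) : Prop :=
  forall k, (s <= k < t)%N ->
    0 < evidence k.+1 (y k.+1) (predict k.+1 (filter_from_to y s k pi)) < +oo.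

Definition stationary_distribution (pi : probability 'rV[R]_n R) : Prop :=
  forall A, measurable A -> predict 1 pi A = pi A.

End filter.

Section process.
Context d (Omega : measurableType d) {R : realType} (P : probability Omega R)
  {n m : nat} {kappa : {sigma_finite_measure set 'rV[R]_m -> \bar R}}.
Variables (X : nat -> {RV P >-> 'rV[R]_n}) (Y : nat -> {RV P >-> 'rV[R]_m}).

(* The last k observations at time t, most recent first: Y_{t,t-k}. *)
Definition obs (t k : nat) (o : Omega) : k.-tuple 'rV[R]_m :=
  [tuple Y (t - i)%N o | i < k].

(* X_0, ..., X_t and Y_t, ..., Y_1. *)
Definition history (t : nat) (o : Omega) :
    t.+1.-tuple 'rV[R]_n * t.-tuple 'rV[R]_m :=
  ([tuple X i o | i < t.+1], obs t t o).

(* (X_t, Y_t), t = 1, ..., N, is generated by the model with X_0 ~ mu: given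
   the past up to time t, X_{t+1} ~ a_{t+1}(. | X_t) and then
   Y_{t+1} ~ h_{t+1}(. | X_{t+1}). The variable Y_0 plays no role. *)
Definition generated_by (mdl : ssm n kappa) (mu : probability 'rV[R]_n R)
    (N : nat) : Prop :=
  (forall A, measurable A -> P (X 0%N @^-1` A) = mu A) /\
  (forall t, (t < N)%N -> forall G A B,
     measurable G -> measurable A -> measurable B ->
     P (history t @^-1` G `&` X t.+1 @^-1` A `&` Y t.+1 @^-1` B) =
     \int[P]_(o in history t @^-1` G)
       \int[trans mdl t.+1 (X t o)]_(x in A)
         \int[kappa]_(y in B) (lik mdl t.+1 y x)%:E)%E.

Definition block (t k : nat) (o : Omega) : k.-tuple ('rV[R]_n * 'rV[R]_m) :=
  [tuple (X (t + i)%N o, Y (t + i)%N o) | i < k].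

Definition stationary_process : Prop :=
  forall (t k : nat) (A : set (k.-tuple ('rV[R]_n * 'rV[R]_m))),
    measurable A -> P (block t.+1 k @^-1` A) = P (block 1 k @^-1` A).

(* pi is a regular conditional distribution of X_t given Y_{t,0}. *)
Definition posterior (t : nat) (pi : t.-tuple 'rV[R]_m -> probability 'rV[R]_n R)
    : Prop :=
  measurable_fun [set: t.-tuple 'rV[R]_m]
    (pi : t.-tuple 'rV[R]_m -> pprobability 'rV[R]_n R) /\
  forall A B, measurable A -> measurable B ->
    P (X t @^-1` A `&` obs t t @^-1` B) =
    (\int[P]_(o in obs t t @^-1` B) pi (obs t t o) A)%E.

End process.

(* nu is the law of (X_w, Y_{w,0}) when X_0 ~ mu. *)
Definition window_law (R : realType) (n m : nat)
    (kappa : {sigma_finite_measure set 'rV[R]_m -> \bar R})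
    (mdl : ssm n kappa) (mu : probability 'rV[R]_n R) (w : nat)
    (nu : probability ('rV[R]_n * w.-tuple 'rV[R]_m)%type R) : Prop :=
  exists (d : measure_display) (Omega : measurableType d)
    (P : probability Omega R)
    (X : nat -> {RV P >-> 'rV[R]_n}) (Y : nat -> {RV P >-> 'rV[R]_m}),
    generated_by X Y mdl mu w /\
    forall A, measurable A -> nu A = P [set o | A (X w o, obs Y w w o)].

(* The shuffling permutation is not part of the data: it belongs to the
   randomness of the procedure. *)
Definition training_data d (Omega : measurableType d) (R : realType)
    (P : probability Omega R) (n m J : nat)
    (Xtr : 'I_J -> nat -> {RV P >-> 'rV[R]_n})
    (Ytr : 'I_J -> nat -> {RV P >-> 'rV[R]_m}) (w : nat) (o : Omega) :
    J.-tuple (w.+1.-tuple 'rV[R]_n * w.-tuple 'rV[R]_m) :=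
  [tuple history (Xtr j) (Ytr j) w o | j < J].

(* f is taken measurable, so that the expectations make sense, and T Borel
   measurable. Values are in \bar R. The conventions make the gap +oo whenever it is
   not well defined: in [objective] the sum is -oo as soon as one of the terms
   is -oo or an indeterminate difference of positive and negative parts, and
   [gap] uses the dual addition, for which +oo - +oo = +oo. Suprema and infima
   coincide with max and min whenever these are attained. *)
Section objective.
Context {R : realType} {n m w : nat}.
Local Notation XY := ('rV[R]_n * w.-tuple 'rV[R]_m)%type.
Variables eta nu : set XY -> \bar R.

Definition objective (f : XY -> R) (T : XY -> 'rV[R]_n) : \bar R :=
  (\int[nu]_p (f p)%:E +
   \int[eta]_p (2^-1 * enorm (T p - p.1) ^+ 2 - f (T p, p.2))%:E)%E.

Definition inf_objective (f : XY -> R) : \bar R :=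
  ereal_inf [set objective f T | T in [set T : XY -> 'rV[R]_n | measurable_fun [set: XY] T]].

Definition c_concave : set (XY -> R) :=
  [set f : XY -> R | measurable_fun [set: XY] f /\
     forall y, convex_function (setT : set (convex_lmodType 'rV[R]_n))
       (fun x => 2^-1 * enorm x ^+ 2 - f (x, y) : R^o)].

Definition sup_inf_objective : \bar R :=
  ereal_sup [set inf_objective f | f in c_concave].

Definition gap (f : XY -> R) (T : XY -> 'rV[R]_n) : \bar R :=
  ((objective f T - inf_objective f) +
   (sup_inf_objective - inf_objective f))%dE.

End objective.

(* Main.v *)
Require Import Defs.
From HB Require Import structures.
From mathcomp Require Import all_boot all_order all_algebra.
From mathcomp Require Import all_classical all_reals all_analysis.
From mathcomp Require Import measurable_realfun ring lra.
Import Order.TTheory GRing.Theory Num.Theory.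
Import numFieldNormedType.Exports.
Local Open Scope classical_set_scope.
Local Open Scope ring_scope.

Set Implicit Arguments.
Unset Strict Implicit.
Unset Printing Implicit Defensive.

(** Let [F] denote the filter restarted from [mu] at time [t - w] and fed with
    the last [w] observations. The triangle inequality in L2 splits the error
    of the learned map into the distance of the push-forward to [F], and the
    distance of [F] to the exact posterior.

    The second distance is handled by stability. Bayes' recursion
    ([filter_step_version]) shows that the filter preserves versions of the
    conditional law of the state given past observations; hence the filter
    started from the posterior at time [t - w] yields a version of the posterior
    at time [t] ([filter_iter_version], [filter_version_unique]), all
    normalizations met on the way are almost surely meaningful
    ([filter_defined_ae]), and stability bounds the distance by
    [C * lambda ^+ w] times a quantity smaller than [M].

    For the first distance, [X_(t-w)] has law [mu] by stationarity, so that the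
    state at time [t] and the last [w] observations have joint law [nu]
    ([window_integral]), and [F] is a conditional law of [nu] given the
    observations. As the training data are independent of the process, they may
    be frozen ([transport_error_le_gap]). It remains to show, for one pair
    [(f, T)] and one Lipschitz function [g], that the gap of the pair is at
    least [alpha / 4] times the mean square of [D y = q y - r y], where [q y] is
    the mean of [g] for the conditional law of [nu] given [y] and [r y] is the
    mean of [g (T (x, y))] for [x] of law [mu] ([gap_ge_mean_square]).

    To that end, one good competitor in the outer maximization is exhibited,
    namely [f + G], where [G (x, y)] is the inf-convolution of [c y * g] with
    the parabola of curvature [alpha / 2], evaluated at [x], for a function [c]
    of the observations. This inf-convolution is semiconcave with that same curvature
    ([envelope_semiconcave]), which the strong convexity of
    [x |-> 2^-1 * enorm x ^+ 2 - f (x, y)] compensates: [f + G] is admissible.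
    For any map [T'], strong convexity at the midpoint of [T] and [T'] gives

      J(f, T') + J(f, T) >= 2 J(f, (T + T')/2) + alpha/4 E |T' - T|^2,

    where the midpoint term is at least twice the minimum of J(f, .). The excess
    alpha/4 E |T' - T|^2 covers what is lost when [G] at [T'] is replaced by
    [c * g] at [T] ([envelope_le]), and replacing [G] by [c * g] under [nu]
    costs [c ^+ 2 / alpha] ([envelope_ge]). Altogether the gap is at least the
    mean of [c y * D y - c y ^+ 2 / alpha] ([gap_ge_dual]), and the choice
    [c = alpha / 2 * D] gives the bound. *)

(** * Euclidean geometry and inf-convolutions of Lipschitz functions *)

Section euclidean.
Context {R : realType} {n : nat}.
Implicit Types x y z : 'rV[R]_n.

Lemma enorm_ge0 x : 0 <= enorm x.
Proof. exact: sqrtr_ge0. Qed.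

Lemma enorm_sqr x : enorm x ^+ 2 = \sum_(i < n) x ord0 i ^+ 2.
Proof. by rewrite sqr_sqrtr// sumr_ge0// => i _; rewrite sqr_ge0. Qed.

Lemma enorm0 : enorm (0 : 'rV[R]_n) = 0.
Proof.
by apply/eqP; rewrite -sqrf_eq0 enorm_sqr big1// => i _; rewrite mxE expr0n.
Qed.

Lemma enorm_distC x y : enorm (x - y) = enorm (y - x).
Proof.
by congr Num.sqrt; apply: eq_bigr => i _; rewrite !mxE -sqrrN opprB.
Qed.

Lemma enorm_sqr_convex x y z (t : R) :
  enorm (t *: x + (1 - t) *: y - z) ^+ 2 =
  t * enorm (x - z) ^+ 2 + (1 - t) * enorm (y - z) ^+ 2
    - t * (1 - t) * enorm (x - y) ^+ 2.
Proof.
rewrite !enorm_sqr !mulr_sumr -big_split -sumrB/=; apply: eq_bigr => i _.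
by rewrite !mxE; ring.
Qed.

(** Young's form of the triangle inequality. *)
Lemma enorm_sqr_young x y z (s : R) : 0 < s ->
  enorm (x - z) ^+ 2 <=
  (1 + s) * enorm (x - y) ^+ 2 + (1 + s^-1) * enorm (y - z) ^+ 2.
Proof.
move=> s0; rewrite !enorm_sqr !mulr_sumr -big_split/=; apply: ler_sum => i _.
rewrite !mxE; set a := x _ _; set b := y _ _; set c := z _ _.
rewrite -subr_ge0.
suff -> : (1 + s) * (a - b) ^+ 2 + (1 + s^-1) * (b - c) ^+ 2 - (a - c) ^+ 2 =
   s * ((a - b) - s^-1 * (b - c)) ^+ 2 by rewrite mulr_ge0 ?sqr_ge0// ltW.
by field; rewrite gt_eqF.
Qed.

Lemma measurable_rV_linear (a b : R) :
  measurable_fun [set: 'rV[R]_n * 'rV[R]_n] (fun p => a *: p.1 + b *: p.2).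
Proof.
apply: measurable_fun_rV => i.
under eq_fun do rewrite !mxE.
apply: measurable_funD; apply: measurable_funM => //.
- exact: (measurableT_comp (measurable_rV_coord i) measurable_fst).
- exact: (measurableT_comp (measurable_rV_coord i) measurable_snd).
Qed.

Lemma measurable_rV_combination d (T : measurableType d) (a b : R)
    (f h : T -> 'rV[R]_n) : measurable_fun setT f -> measurable_fun setT h ->
  measurable_fun setT (fun t => a *: f t + b *: h t).
Proof.
move=> mf mh.
exact: (measurableT_comp (measurable_rV_linear a b)
  (measurable_fun_pair mf mh)).
Qed.

Lemma measurable_enorm : measurable_fun [set: 'rV[R]_n] enorm.
Proof.
apply: measurableT_comp; first by apply: continuous_measurable_fun; exact: sqrt_continuous.
apply: measurable_sum => i.
by apply: measurable_funX; exact: measurable_rV_coord.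
Qed.

Lemma measurable_enorm_dist d (T : measurableType d) (f h : T -> 'rV[R]_n) :
  measurable_fun setT f -> measurable_fun setT h ->
  measurable_fun setT (fun t => enorm (f t - h t)).
Proof.
move=> mf mh; apply: measurableT_comp; first exact: measurable_enorm.
have := measurable_rV_combination 1 (-1) mf mh.
by under eq_fun do rewrite scale1r scaleN1r.
Qed.

(** A countable dense family, which turns infima over the whole space into
    countable ones. *)
Definition rat_point (k : nat) : 'rV[R]_n :=
  if unpickle k is Some q then map_mx ratr (q : 'rV[rat]_n) else 0.

Lemma rat_point_dense x (e : R) : 0 < e -> exists k, enorm (x - rat_point k) < e.
Proof.
move=> e0.
pose e' := e / n.+1%:R.
have e'0 : 0 < e' by rewrite divr_gt0.
have /choice[q qP] : forall i, exists q : rat, ratr q \in `]x ord0 i, (x ord0 i + e')[.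
  by move=> i; apply: rat_in_itvoo; rewrite ltrDl.
exists (pickle (\row_i q i : 'rV[rat]_n)).
rewrite /rat_point pickleK.
rewrite -(@ltr_pXn2r _ 2)// ?nnegrE ?enorm_ge0 ?(ltW e0)//.
rewrite enorm_sqr (@le_lt_trans _ _ (\sum_(i < n) e' ^+ 2))//.
  apply: ler_sum => i _; rewrite !mxE -sqrrN opprB.
  move: (qP i); rewrite in_itv/= => /andP[q1 q2].
  by rewrite ler_pXn2r// ?nnegrE; lra.
rewrite sumr_const card_ord -mulr_natl /e' expr_div_n mulrA ltr_pdivrMr ?exprn_gt0//.
rewrite mulrC ltr_pM2l ?exprn_gt0// -natrX ltr_nat.
by rewrite (leq_trans (ltnSn n))// expnS leq_pmulr// expn_gt0.
Qed.

End euclidean.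

(** Strict sublevel sets of an infimum are unions, hence countable infima are
    measurable. *)
Lemma measurable_fun_countable_inf d (T : measurableType d) (R : realType)
    (f : T -> R) (f_ : nat -> T -> R) :
  (forall k, measurable_fun setT (f_ k)) ->
  (forall t a, f t < a <-> exists k, f_ k t < a) ->
  measurable_fun setT f.
Proof.
move=> mf fP.
move=> mD; apply: (measurability _ (RGenInftyO.measurableE R)) => //.
move=> _ [_ [a ->] <-]; rewrite setTI.
have -> : f @^-1` `]-oo, a[ = \bigcup_k (f_ k @^-1` `]-oo, a[).
  apply/seteqP; split => [t|t [k _]]/=; rewrite !in_itv/= => h.
    by have /fP[k kP] := h; exists k => //=; rewrite in_itv.
  by apply/fP; exists k.
by apply: bigcupT_measurable => k; rewrite -[X in measurable X]setTI; exact: mf.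
Qed.

Section lipschitz.
Context {R : realType} {n : nat}.
Implicit Types (g : 'rV[R]_n -> R) (x y z : 'rV[R]_n).

(** McShane's formula along a dense sequence. *)
Lemma measurable_bounded_lipschitz g :
  bounded_lipschitz g -> measurable_fun setT g.
Proof.
move=> [_ gL].
apply: (@measurable_fun_countable_inf _ _ _ _
    (fun k x => g (rat_point k) + enorm (x - rat_point k))) => [k|x a].
  by apply: measurable_funD => //; exact: measurable_enorm_dist.
split=> [gxa|[k]]; last first.
  by apply: le_lt_trans; have := gL x (rat_point k); rewrite ler_norml; lra.
have [k xk] := rat_point_dense x (e := (a - g x) / 2) ltac:(lra).
exists k; have := gL x (rat_point k); rewrite ler_norml; lra.
Qed.

End lipschitz.

Section envelope.
Context {R : realType} {n : nat}.
Variables (a : R) (g : 'rV[R]_n -> R).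
Hypotheses (a_gt0 : 0 < a) (gP : bounded_lipschitz g).
Implicit Types (x y z : 'rV[R]_n) (c : R).

Let cost c x k : R := c * g (rat_point k) + a / 4 * enorm (x - rat_point k) ^+ 2.

(** The inf-convolution of [c * g] with the parabola of curvature [a / 2]. By
    density the rational points give the same infimum as the whole space, and
    they make measurability in [c] and [x] immediate. *)
Definition envelope c x : R := inf (range (cost c x)).

Let g_le1 x : `|g x| <= 1. Proof. exact: gP.1. Qed.
Let g_lip x y : `|g x - g y| <= enorm (x - y). Proof. exact: gP.2. Qed.

Let cost_ge c x k : c * g x - c ^+ 2 / a <= cost c x k.
Proof.
rewrite /cost; set z := rat_point k; set r := enorm (x - z).
have cg : c * (g x - g z) <= `|c| * r.
  by rewrite (le_trans (ler_norm _))// normrM ler_wpM2l.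
(* the minimum of [a / 4 * r ^+ 2 - `|c| * r] over [r] is [- c ^+ 2 / a] *)
have : 0 <= a / 4 * (r - 2 * `|c| / a) ^+ 2.
  by rewrite mulr_ge0 ?sqr_ge0// divr_ge0// ltW.
have -> : a / 4 * (r - 2 * `|c| / a) ^+ 2 =
    a / 4 * r ^+ 2 - `|c| * r + `|c| ^+ 2 / a by field; rewrite gt_eqF.
rewrite real_normK ?num_real//; lra.
Qed.

Let cost_has_inf c x : has_inf (range (cost c x)).
Proof.
split; first by exists (cost c x 0%N); exists 0%N.
by exists (c * g x - c ^+ 2 / a) => _ [k _ <-]; exact: cost_ge.
Qed.

Let envelope_le_cost c x k : envelope c x <= cost c x k.
Proof. by apply: ge_inf; [exact: (cost_has_inf c x).2|exists k]. Qed.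

Lemma envelope_ge c x : c * g x - c ^+ 2 / a <= envelope c x.
Proof.
apply: lb_le_inf; first exact: (cost_has_inf c x).1.
by move=> _ [k _ <-]; exact: cost_ge.
Qed.

(** Every point, and not only the rational ones, may be used in the infimum:
    approximate it by a rational point, at a cost that Young's inequality makes
    arbitrarily small. *)
Lemma envelope_le c x y : envelope c x <= c * g y + a / 4 * enorm (x - y) ^+ 2.
Proof.
apply/ler_addgt0Pr => e e0.
have [s s0 sE] : exists2 s, 0 < s & a / 4 * s * enorm (x - y) ^+ 2 <= e / 2.
  pose b := a / 4 * enorm (x - y) ^+ 2 + 1.
  have b1 : 1 <= b by rewrite lerDr mulr_ge0 ?sqr_ge0// divr_ge0// ltW.
  have b0 : 0 < b by lra.
  exists (e / 2 / b); first by rewrite !divr_gt0.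
  have -> : a / 4 * (e / 2 / b) * enorm (x - y) ^+ 2 =
    e / 2 * ((b - 1) / b) by rewrite {2}/b; field; rewrite gt_eqF.
  by rewrite ler_piMr ?ler_pdivrMr//; lra.
pose K := `|c| + a / 4 * (1 + s^-1) + 1.
have K0 : 0 < K.
  have : 0 <= a / 4 * (1 + s^-1).
    by rewrite mulr_ge0 ?divr_ge0 ?addr_ge0 ?invr_ge0// ltW.
  by have := normr_ge0 c; rewrite /K; lra.
pose e' := Num.min 1 (e / 2 / K).
have e'0 : 0 < e' by rewrite lt_min ltr01/= !divr_gt0.
have [k yk] := rat_point_dense y e'0.
apply: (le_trans (envelope_le_cost c x k)); rewrite /cost.
set z := rat_point k in yk *; set r := enorm (y - z) in yk.
have r0 : 0 <= r by exact: enorm_ge0.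
have r2 : r ^+ 2 <= r.
  rewrite expr2 ler_piMr//; apply: ltW; apply: lt_le_trans yk _.
  by rewrite ge_min lexx.
have cg : c * g z <= c * g y + `|c| * r.
  rewrite -lerBlDl -mulrBr (le_trans (ler_norm _))// normrM ler_wpM2l//.
  by rewrite distrC; exact: g_lip.
have := enorm_sqr_young x y z s0.
rewrite -(ler_pM2l (_ : 0 < a / 4)) ?divr_gt0// => yng.
have : K * r <= e / 2.
  rewrite mulrC -ler_pdivlMr//; apply: ltW; apply: lt_le_trans yk _.
  by rewrite ge_min lexx orbT.
have : a / 4 * (1 + s^-1) * r ^+ 2 <= a / 4 * (1 + s^-1) * r.
  by rewrite ler_wpM2l// mulr_ge0 ?divr_ge0 ?addr_ge0 ?invr_ge0// ltW.
rewrite /K -/r in yng *; nra.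
Qed.

Lemma envelope_norm c x : `|envelope c x| <= `|c|.
Proof.
rewrite ler_norml; apply/andP; split.
  apply: lb_le_inf; first exact: (cost_has_inf c x).1.
  move=> _ [k _ <-]; rewrite /cost.
  have : - `|c| <= c * g (rat_point k).
    have : `|c * g (rat_point k)| <= `|c| by rewrite normrM ler_piMr.
    by rewrite ler_norml => /andP[].
  have : 0 <= a / 4 * enorm (x - rat_point k) ^+ 2.
    by rewrite mulr_ge0 ?sqr_ge0// divr_ge0// ltW.
  lra.
apply: (le_trans (envelope_le c x x)).
rewrite subrr enorm0 expr0n mulr0 addr0 (le_trans (ler_norm _))//.
by rewrite normrM ler_piMr.
Qed.

(** An infimum of parabolas of curvature [a / 2] is semiconcave. *)
Lemma envelope_semiconcave c x y t : 0 <= t <= 1 ->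
  t * envelope c x + (1 - t) * envelope c y
    - a / 4 * t * (1 - t) * enorm (x - y) ^+ 2
  <= envelope c (t *: x + (1 - t) *: y).
Proof.
move=> /andP[t0 t1]; apply: lb_le_inf; first exact: (cost_has_inf _ _).1.
move=> _ [k _ <-]; rewrite /cost enorm_sqr_convex.
have hx := ler_wpM2l t0 (envelope_le_cost c x k).
have hy : (1 - t) * envelope c y <= (1 - t) * cost c y k.
  by rewrite ler_wpM2l// subr_ge0.
by move: hx hy; rewrite /cost; lra.
Qed.

Lemma measurable_envelope d (T : measurableType d) (c : T -> R) (x : T -> 'rV[R]_n) :
  measurable_fun setT c -> measurable_fun setT x ->
  measurable_fun setT (fun t => envelope (c t) (x t)).
Proof.
move=> mc mx.
apply: (@measurable_fun_countable_inf _ _ _ _ (fun k t => cost (c t) (x t) k)) => [k|t b].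
  apply: measurable_funD; first exact: measurable_funM.
  apply: measurable_funM => //; apply: measurable_funX.
  exact: measurable_enorm_dist.
split=> [|[k]]; last by apply: le_lt_trans; exact: envelope_le_cost.
by move=> /(inf_lt (cost_has_inf _ _).1)[_ [k _ <-]] ?; exists k.
Qed.

End envelope.

(** * Lower bounds for the optimality gap *)

Section integral_order.
Local Open Scope ereal_scope.

(** Both parts of an integral are suprema over the simple functions below the
    integrand, hence monotone for any set function and any integrand. *)
Lemma le_integral_pointwise d (T : measurableType d) (R : realType)
    (m : set T -> \bar R) (f h : T -> \bar R) : (forall x, f x <= h x) ->
  \int[m]_x f x <= \int[m]_x h x.
Proof.
move=> fh; rewrite /integral; apply: leeB; apply: ereal_sup_le => _ [k kP <-];
  exists k => // x; apply: le_trans (kP x) _.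
- by rewrite !patch_setT; apply: (@funepos_le _ _ setT) => [y _|]; rewrite ?inE.
- by rewrite !patch_setT; apply: (@funeneg_le _ _ setT) => [y _|]; rewrite ?inE.
Qed.

Variables (d : measure_display) (T : measurableType d) (R : realType).
Implicit Types m : {measure set T -> \bar R}.

Lemma bounded_integrable (P : probability T R) (f : T -> R) (K : R) :
  measurable_fun setT f -> (forall x, (`|f x| <= K)%R) ->
  P.-integrable setT (EFin \o f).
Proof.
move=> mf fK; apply: measurable_bounded_integrable => //.
  by apply: (le_lt_trans (probability_le1 _ _)); rewrite ?ltry.
exists K; split; first by rewrite num_real.
by move=> r Kr x _; exact: le_trans (fK x) (ltW Kr).
Qed.

Lemma fin_num_integral_integrable m (f : T -> R) : measurable_fun setT f ->
  \int[m]_x (f x)%:E \is a fin_num -> m.-integrable setT (EFin \o f).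
Proof.
move=> mf; rewrite integralE fin_numB => /andP[fp fn].
have /measurable_EFinP mf' := mf.
apply/integrableP; split => //.
rewrite (eq_integral (fun x => (EFin \o f)^\+ x + (EFin \o f)^\- x)).
  rewrite ge0_integralD//.
  - by rewrite lte_add_pinfty// -ge0_fin_numE// integral_ge0.
  - exact: measurable_funepos.
  - exact: measurable_funeneg.
by move=> x _; rewrite -/((abse \o (EFin \o f)) x) fune_abse.
Qed.

(** The integral of [a] may be [+oo], and then so is the one of [b]. This lets
    a bound on the loss of a midpoint map pass to an arbitrary competitor, whose
    loss is not known to be integrable. *)
Lemma integral_ge_affine m (a b l : T -> R) :
  measurable_fun setT a -> measurable_fun setT b ->
  m.-integrable setT (EFin \o l) ->
  (forall x, (2 * a x - l x <= b x)%R) -> -oo < \int[m]_x (a x)%:E ->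
  2%:E * \int[m]_x (a x)%:E - \int[m]_x (l x)%:E <= \int[m]_x (b x)%:E.
Proof.
move=> ma mb il ab aNy.
have lfin : \int[m]_x (l x)%:E \is a fin_num by exact: integrable_fin_num.
have [afin|ainf] := boolP (\int[m]_x (a x)%:E \is a fin_num).
  have ia := fin_num_integral_integrable ma afin.
  have i2a : m.-integrable setT (fun x => 2%:E * (a x)%:E) by exact: integrableZl.
  rewrite -integralZl// -integralB//.
  by apply: le_integral_pointwise => x; rewrite -EFinM -EFinB lee_fin.
have ay : \int[m]_x (a x)%:E = +oo.
  by move: ainf aNy; case: (\int[m]_x (a x)%:E).
suff -> : \int[m]_x (b x)%:E = +oo by rewrite leey.
pose A := EFin \o a; pose B := EFin \o b.
have mA : measurable_fun setT A by exact/measurable_EFinP.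
have mB : measurable_fun setT B by exact/measurable_EFinP.
have mAp := measurable_funepos mA; have mAn := measurable_funeneg mA.
have mBp := measurable_funepos mB; have mBn := measurable_funeneg mB.
have ml : measurable_fun setT (EFin \o l) by exact: measurable_int il.
have mla : measurable_fun setT (fun x => `|(l x)%:E|) by exact: measurableT_comp.
have lfa : \int[m]_x `|(l x)%:E| < +oo by have /integrableP[] := il.
have [Apy Anf] : \int[m]_x A^\+ x = +oo /\ \int[m]_x A^\- x < +oo.
  move: ay; rewrite integralE.
  have : 0 <= \int[m]_x A^\+ x by exact: integral_ge0.
  have : 0 <= \int[m]_x A^\- x by exact: integral_ge0.
  rewrite -/A; case: (\int[m]_x A^\- x) => [r| |]//; case: (\int[m]_x A^\+ x) => [s| |]//.
  by rewrite ltry.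
rewrite integralE -/B.
have Bpy : \int[m]_x B^\+ x = +oo.
  have : \int[m]_x A^\+ x <= \int[m]_x (B^\+ x + `|(l x)%:E|).
    apply: le_integral_pointwise => x.
    rewrite !funeposE /A /B /= -!EFin_max -EFinD lee_fin.
    have := ab x; have := ler_norm (l x); have := normr_ge0 (l x).
    by case: (leP (a x) 0%R) => ?; case: (leP (b x) 0%R) => ?; lra.
  rewrite Apy leye_eq ge0_integralD// => /eqP.
  by move: lfa; case: (\int[m]_x `|(l x)%:E|) => //; case: (\int[m]_x B^\+ x).
have Bnf : \int[m]_x B^\- x < +oo.
  have : \int[m]_x B^\- x <= \int[m]_x (2%:E * A^\- x + `|(l x)%:E|).
    apply: le_integral_pointwise => x.
    rewrite !funenegE /A /B /= -!EFin_max -EFinM -EFinD lee_fin.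
    have := ab x; have := ler_norm (l x); have := normr_ge0 (l x).
    by case: (leP (- a x)%R 0%R) => ?; case: (leP (- b x)%R 0%R) => ?; lra.
  move=> /le_lt_trans; apply; rewrite ge0_integralD//; last 2 first.
    by move=> x _; rewrite mule_ge0.
    exact: measurable_funeM.
  by rewrite ge0_integralZl// lte_add_pinfty// lte_mul_pinfty.
rewrite Bpy; have : 0 <= \int[m]_x B^\- x by exact: integral_ge0.
by move: Bnf; case: (\int[m]_x B^\- x).
Qed.

End integral_order.

Section gap.
Context {R : realType} {n m w : nat}.
Local Notation XY := ('rV[R]_n * w.-tuple 'rV[R]_m)%type.
Variables (eta nu : probability XY R) (alpha : R) (f : XY -> R).
Hypotheses (alpha_gt0 : 0 < alpha) (mf : measurable_fun setT f)
  (f_conv : forall y, strongly_convex alpha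
    (fun x => 2^-1 * enorm x ^+ 2 - f (x, y))).

Let loss (h : XY -> R) (T : XY -> 'rV[R]_n) p :=
  2^-1 * enorm (T p - p.1) ^+ 2 - h (T p, p.2).

Let measurable_loss h T : measurable_fun setT h -> measurable_fun setT T ->
  measurable_fun setT (loss h T).
Proof.
move=> mh mT; apply: measurable_funB.
  apply: measurable_funM => //; apply: measurable_funX.
  by apply: measurable_enorm_dist => //; exact: measurable_fst.
apply: (measurableT_comp mh).
by apply: measurable_fun_pair => //; exact: measurable_snd.
Qed.

(** Strong convexity at the midpoint of two maps; the parallelogram identity
    takes care of the quadratic cost. *)
Let loss_midpoint (T T' : XY -> 'rV[R]_n) p :
  2 * loss f (fun p => 2^-1 *: T p + 2^-1 *: T' p) p
    + alpha / 4 * enorm (T p - T' p) ^+ 2 <=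
  loss f T p + loss f T' p.
Proof.
have h : 0 <= (2^-1 : R) <= 1 by apply/andP; split; lra.
have := f_conv p.2 (T p) (T' p) h.
have e : 1 - 2^-1 = 2^-1 :> R by field.
rewrite /loss e.
have := enorm_sqr_convex (T p) (T' p) 0 (2^-1).
have := enorm_sqr_convex (T p) (T' p) p.1 (2^-1).
rewrite !subr0 e.
lra.
Qed.

Section test_potential.
Variables (g : 'rV[R]_n -> R) (c : w.-tuple 'rV[R]_m -> R) (K : R).
Hypotheses (gP : bounded_lipschitz g) (mc : measurable_fun setT c)
  (cK : forall y, `|c y| <= K).

Let G (p : XY) : R := envelope alpha g (c p.2) p.1.

Let mG : measurable_fun setT G.
Proof.
apply: (measurable_envelope alpha_gt0 gP); last exact: measurable_fst.
by apply: (measurableT_comp mc); exact: measurable_snd.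
Qed.

Let G_le_K p : `|G p| <= K.
Proof. exact: le_trans (envelope_norm alpha_gt0 gP _ _) (cK p.2). Qed.

Let iG : nu.-integrable setT (EFin \o G).
Proof. exact: bounded_integrable G_le_K. Qed.

Let c_concave_test : c_concave (fun p => f p + G p).
Proof.
split; first exact: measurable_funD.
move=> y t x1 x2 _ _.
have t01 : 0 <= t%:num <= 1 by apply/andP; split.
have := f_conv y x1 x2 t01.
have := envelope_semiconcave alpha_gt0 gP (c y) x1 x2 t01.
have : 0 <= alpha / 4 * t%:num * (1 - t%:num) * enorm (x1 - x2 : 'rV[R]_n) ^+ 2.
  case/andP: t01 => t0 t1.
  apply: mulr_ge0; last exact: sqr_ge0.
  apply: mulr_ge0; last by rewrite subr_ge0.
  by apply: mulr_ge0 => //; rewrite divr_ge0// ltW.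
move=> h1 h2 h3; pose z : 'rV[R]_n := t%:num *: x1 + (1 - t%:num) *: x2.
change (2^-1 * enorm z ^+ 2 - (f (z, y) + G (z, y)) <=
  t%:num * (2^-1 * enorm (x1 : 'rV[R]_n) ^+ 2 - (f (x1, y) + G (x1, y))) +
  (1 - t%:num) * (2^-1 * enorm (x2 : 'rV[R]_n) ^+ 2 - (f (x2, y) + G (x2, y)))).
rewrite /G/=; move: h1 h2 h3; rewrite -/z; lra.
Qed.

Variable T : XY -> 'rV[R]_n.
Hypothesis mT : measurable_fun setT T.

Let mcg : measurable_fun setT (fun p : XY => c p.2 * g p.1).
Proof.
apply: measurable_funM.
  by apply: (measurableT_comp mc); exact: measurable_snd.
apply: (measurableT_comp (measurable_bounded_lipschitz gP)).
exact: measurable_fst.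
Qed.

Let mc2 : measurable_fun setT (fun p : XY => c p.2 ^+ 2 / alpha).
Proof.
apply: measurable_funM => //; apply: measurable_funX.
by apply: (measurableT_comp mc); exact: measurable_snd.
Qed.

Let mcgT : measurable_fun setT (fun p : XY => c p.2 * g (T p)).
Proof.
apply: measurable_funM.
  by apply: (measurableT_comp mc); exact: measurable_snd.
exact: (measurableT_comp (measurable_bounded_lipschitz gP)).
Qed.

Let icgT : eta.-integrable setT (EFin \o (fun p : XY => c p.2 * g (T p))).
Proof.
apply: (@bounded_integrable _ _ _ eta _ K) => // p; rewrite normrM.
by apply: le_trans (cK p.2); rewrite ler_piMr//; exact: gP.1.
Qed.

Let icg : nu.-integrable setT
  (EFin \o (fun p : XY => c p.2 * g p.1 - c p.2 ^+ 2 / alpha)).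
Proof.
apply: (@bounded_integrable _ _ _ nu _ (K + K ^+ 2 / alpha)).
  exact: measurable_funB.
move=> p; apply: (le_trans (ler_normB _ _)); apply: lerD.
  rewrite normrM; apply: le_trans (cK p.2).
  by rewrite ler_piMr//; exact: gP.1.
have ca : 0 <= alpha^-1 by rewrite invr_ge0 ltW.
rewrite normrM normrX (ger0_norm ca) ler_wpM2r//.
have K0 : 0 <= K by exact: le_trans (cK p.2).
by rewrite ler_pXn2r ?nnegrE.
Qed.

Local Open Scope ereal_scope.

(** [I] and [A] are the infimum and the value at [T] of the objective of [f].
    The midpoint of [T] and [T'] is a competitor for the infimum. *)
Let objective_test_ge (I A : R) (T' : XY -> 'rV[R]_n) :
  measurable_fun setT T' -> inf_objective eta nu f = I%:E ->
  objective eta nu f T = A%:E ->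
  (2 * I - A)%:E +
  (\int[nu]_p (c p.2 * g p.1 - c p.2 ^+ 2 / alpha)%:E -
   \int[eta]_p (c p.2 * g (T p))%:E) <=
  objective eta nu (fun p => f p + G p)%R T'.
Proof.
move=> mT' infE objE.
pose mid p := (2^-1 *: T p + 2^-1 *: T' p)%R.
have mmid : measurable_fun setT mid by exact: measurable_rV_combination.
have : I%:E <= objective eta nu f mid.
  by rewrite -infE; apply: ereal_inf_lbound; exists mid.
move: objE; rewrite /objective -/(loss f T) -/(loss f mid).
have -> : (fun p => (2^-1 * enorm (T p - p.1) ^+ 2 - f (T p, p.2))%:E) =
  EFin \o loss f T by [].
have -> : (fun p => (2^-1 * enorm (mid p - p.1) ^+ 2 - f (mid p, p.2))%:E) =
  EFin \o loss f mid by [].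
have -> : (fun p => (2^-1 * enorm (T' p - p.1) ^+ 2 -
    (f (T' p, p.2) + G (T' p, p.2)))%:E) =
  EFin \o loss (fun p => f p + G p)%R T' by [].
move=> objE midE.
have /andP[Ffin Tfin] : (\int[nu]_p (f p)%:E \is a fin_num) &&
    (\int[eta]_p (loss f T p)%:E \is a fin_num).
  by rewrite -fin_numD objE.
have iF := fin_num_integral_integrable mf Ffin.
have iT := fin_num_integral_integrable (measurable_loss mf mT) Tfin.
pose l p := (loss f T p + c p.2 * g (T p))%R.
have il : eta.-integrable setT (EFin \o l) by exact: (integrableD measurableT iT icgT).
have lE : \int[eta]_p (l p)%:E =
    \int[eta]_p (loss f T p)%:E + \int[eta]_p (c p.2 * g (T p))%:E.
  by rewrite -integralD_EFin.
have FGE : \int[nu]_p (f p + G p)%:E =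
    \int[nu]_p (f p)%:E + \int[nu]_p (G p)%:E by rewrite -integralD_EFin.
have midNy : -oo < \int[eta]_p (loss f mid p)%:E.
  move: midE; rewrite ltNye; apply: contraTneq => ->.
  by move: Ffin; case: (\int[nu]_p (f p)%:E).
have key p : (2 * loss f mid p - l p <= loss (fun p => f p + G p)%R T' p)%R.
  have := loss_midpoint T T' p.
  have := envelope_le alpha_gt0 gP (c p.2) (T' p) (T p).
  rewrite (_ : loss (fun p => f p + G p)%R T' p =
    loss f T' p - G (T' p, p.2))%R; last by rewrite /loss opprD addrA.
  rewrite enorm_distC /l -/mid /G/=; lra.
have := integral_ge_affine (measurable_loss mf mmid)
  (measurable_loss (measurable_funD mf mG) mT') il key midNy.
have cgG : \int[nu]_p (c p.2 * g p.1 - c p.2 ^+ 2 / alpha)%:E <=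
    \int[nu]_p (G p)%:E.
  by apply: le_integral_pointwise => p; rewrite lee_fin; exact: envelope_ge.
have icgTfin : \int[eta]_p (c p.2 * g (T p))%:E \is a fin_num.
  exact: integrable_fin_num icgT.
have icgfin : \int[nu]_p (c p.2 * g p.1 - c p.2 ^+ 2 / alpha)%:E \is a fin_num.
  exact: integrable_fin_num icg.
have iGfin : \int[nu]_p (G p)%:E \is a fin_num by exact: integrable_fin_num iG.
rewrite FGE lE /=.
move: objE midE Ffin Tfin cgG icgTfin icgfin iGfin midNy; rewrite /=.
case: (\int[nu]_p (f p)%:E) => // F.
case: (\int[eta]_p (loss f T p)%:E) => // T0.
case: (\int[eta]_p (c p.2 * g (T p))%:E) => // q2.
case: (\int[nu]_p (c p.2 * g p.1 - c p.2 ^+ 2 / alpha)%:E) => // q1.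
case: (\int[nu]_p (G p)%:E) => // g1.
case: (\int[eta]_p (loss f mid p)%:E) => // [x|].
  case: (\int[eta]_p (loss (fun p => f p + G p)%R T' p)%:E) => // [b|]; last first.
    by move=> *; rewrite addey// leey.
  move=> [objE]; rewrite !lee_fin => ? _ _ ? _ _ _ _; lra.
move=> _ _ _ _ _ _ _ _ _.
rewrite gt0_muley ?lte_fin// addye// leye_eq => /eqP ->.
by rewrite addey// leey.
Qed.

(** If the objective at [f] and [T] or its infimum over the maps is not finite,
    the conventions of [gap] make it [+oo]. Otherwise [f + G] bounds the outer supremum from below. *)
Lemma gap_ge_dual :
  \int[nu]_p (c p.2 * g p.1 - c p.2 ^+ 2 / alpha)%:E -
   \int[eta]_p (c p.2 * g (T p))%:E <= gap eta nu f T.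
Proof.
have icgTfin : \int[eta]_p (c p.2 * g (T p))%:E \is a fin_num.
  exact: integrable_fin_num icgT.
have icgfin : \int[nu]_p (c p.2 * g p.1 - c p.2 ^+ 2 / alpha)%:E \is a fin_num.
  exact: integrable_fin_num icg.
have infA : inf_objective eta nu f <= objective eta nu f T.
  by apply: ereal_inf_lbound; exists T.
rewrite /gap.
case infE : (inf_objective eta nu f) infA => [I| |].
- case objE : (objective eta nu f T) => [A| |] // _.
    have : (2 * I - A)%:E +
        (\int[nu]_p (c p.2 * g p.1 - c p.2 ^+ 2 / alpha)%:E -
         \int[eta]_p (c p.2 * g (T p))%:E) <= sup_inf_objective eta nu.
      apply: le_ereal_sup_tmp; exists (inf_objective eta nu (fun p => f p + G p)%R).
        by exists (fun p => f p + G p)%R.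
      apply: le_ereal_inf_tmp => _ [T' mT' <-].
      exact: objective_test_ge.
    move: icgTfin icgfin.
    case: (\int[eta]_p (c p.2 * g (T p))%:E) => // q2 _.
    case: (\int[nu]_p (c p.2 * g p.1 - c p.2 ^+ 2 / alpha)%:E) => // q1 _.
    case: (sup_inf_objective eta nu) => [S| |] //.
      by rewrite -!EFinD !lee_fin; lra.
    by move=> _; rewrite leey.
  by rewrite leey.
- by case: (objective eta nu f T) => // _; rewrite leey.
- by case: (objective eta nu f T) => *; rewrite leey.
Qed.

End test_potential.
End gap.

Lemma normrM_le (R : realDomainType) (K a b : R) :
  `|a| <= K -> `|b| <= 1 -> `|a * b| <= K.
Proof. by move=> aK b1; rewrite normrM (le_trans _ aK)// ler_piMr. Qed.

Section image_law.
Context d1 d2 (T1 : measurableType d1) (T2 : measurableType d2) (R : realType).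
Variables (P : probability T1 R) (f : T1 -> T2).
Hypothesis mf : measurable_fun setT f.

Let f_mixin := isMeasurableFun.Build _ _ _ _ _ mf.
Let f_mfun : {mfun T1 >-> T2} := HB.pack f f_mixin.

(** [distribution] for a function whose measurability is a separate proof. *)
Definition image_law : probability T2 R := distribution P f_mfun.

Lemma image_lawE (A : set T2) : image_law A = P (f @^-1` A).
Proof. by []. Qed.

Local Open Scope ereal_scope.

Lemma ge0_integral_image_law (h : T2 -> \bar R) :
  measurable_fun setT h -> (forall y, 0 <= h y) ->
  \int[image_law]_y h y = \int[P]_x h (f x).
Proof. by move=> mh h0; rewrite /image_law ge0_integral_distribution. Qed.

Lemma bounded_integral_image_law (h : T2 -> R) (K : R) :
  measurable_fun setT h -> (forall y, `|h y| <= K)%R ->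
  \int[image_law]_y (h y)%:E = \int[P]_x (h (f x))%:E.
Proof.
move=> mh hK; rewrite /image_law (integral_distribution (X := f_mfun))//.
  exact/measurable_EFinP.
apply: (@bounded_integrable _ _ _ P (fun x => h (f x)) K) => //.
exact: measurableT_comp mh mf.
Qed.

End image_law.

Section bounded_Rintegral.
Context d (T : measurableType d) (R : realType) (P : probability T R).
Variables (f : T -> R) (K : R).
Hypotheses (mf : measurable_fun setT f) (fK : forall x, `|f x| <= K).

Lemma EFin_Rintegral : (\int[P]_x f x)%:E = (\int[P]_x (f x)%:E)%E.
Proof.
rewrite /Rintegral fineK//.
exact: (integrable_fin_num measurableT (bounded_integrable P mf fK)).
Qed.

Lemma Rintegral_norm_le : `|\int[P]_x f x| <= K.
Proof.
rewrite -lee_fin EFin_normr_Rintegral//; last exact: bounded_integrable fK.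
apply: (le_trans (le_abse_integral _ measurableT _)).
  exact/measurable_EFinP.
apply: (@le_trans _ _ (\int[P]_x (cst K%:E x))%E).
  by apply: le_integral_pointwise => x; rewrite /= lee_fin.
have PT : (P setT = 1)%E by exact: probability_setT.
by rewrite integral_cst// [X in (_ * X)%E]PT mule1.
Qed.

End bounded_Rintegral.

(** The function [q] plays the role of the conditional mean of [g] given the
    observations, which [q_cond] characterizes. *)
Section gap_mean_square.
Context {R : realType} {n m w : nat}.
Local Notation Obs := (w.-tuple 'rV[R]_m).
Local Notation XY := ('rV[R]_n * Obs)%type.
Variables (mu : probability 'rV[R]_n R) (nu : probability XY R) (alpha : R).
Variables (f : XY -> R) (T : XY -> 'rV[R]_n) (g : 'rV[R]_n -> R) (q : Obs -> R).
Hypotheses (alpha_gt0 : 0 < alpha) (mf : measurable_fun setT f)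
  (mT : measurable_fun setT T)
  (f_conv : forall y, strongly_convex alpha
    (fun x => 2^-1 * enorm x ^+ 2 - f (x, y)))
  (gP : bounded_lipschitz g) (mq : measurable_fun setT q)
  (q_le1 : forall y, `|q y| <= 1)
  (q_cond : forall (c : Obs -> R) K, measurable_fun setT c ->
    (forall y, `|c y| <= K) ->
    (\int[nu]_p (c p.2 * g p.1)%:E = \int[nu]_p (c p.2 * q p.2)%:E)%E).

Let mg : measurable_fun setT g := measurable_bounded_lipschitz gP.
Let nuY : probability Obs R := image_law nu (@measurable_snd _ _ 'rV[R]_n Obs).
Let r (y : Obs) : R := \int[mu]_x g (T (x, y)).

Let mgT : measurable_fun setT (g \o T).
Proof. exact: measurableT_comp mg mT. Qed.

Let mgTy y : measurable_fun setT (fun x => g (T (x, y))).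
Proof. exact: measurableT_comp mgT (measurable_pair2 y). Qed.

Let r_le1 y : `|r y| <= 1.
Proof. by apply: Rintegral_norm_le => // x; exact: gP.1. Qed.

Let igT : (mu \x nuY)%E.-integrable setT (EFin \o (g \o T)).
Proof. by apply: (@bounded_integrable _ _ _ (mu \x nuY)%E _ 1) => // x; exact: gP.1. Qed.

Let mr : measurable_fun setT r.
Proof.
apply: measurableT_comp; first exact: fine_measurable.
exact: (measurable_fubini_G igT).
Qed.

(** The maximizer of [c * (q - r) - c ^+ 2 / alpha], pointwise. *)
Let c y := alpha / 2 * (q y - r y).

Let mc : measurable_fun setT c.
Proof. by apply: measurable_funM => //; exact: measurable_funB. Qed.

Let c_le y : `|c y| <= alpha.
Proof.
have a2 : 0 <= alpha / 2 by rewrite divr_ge0// ltW.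
rewrite normrM (ger0_norm a2).
have : `|q y - r y| <= 2.
  by apply: (le_trans (ler_normB _ _)); have := q_le1 y; have := r_le1 y; lra.
by move=> /(ler_wpM2l a2); lra.
Qed.

Local Open Scope ereal_scope.

Lemma gap_ge_mean_square :
  (alpha / 4)%:E * \int[nu]_p ((q p.2 - r p.2) ^+ 2)%:E <=
  gap (mu \x pushforward nu snd) nu f T.
Proof.
have := gap_ge_dual (mu \x nuY) nu alpha_gt0 mf f_conv gP mc c_le mT.
apply: le_trans.
have mc2 : measurable_fun setT (fun p : XY => c p.2).
  exact: measurableT_comp mc measurable_snd.
have mr2 : measurable_fun setT (fun p : XY => r p.2).
  exact: measurableT_comp mr measurable_snd.
have mq2 : measurable_fun setT (fun p : XY => q p.2).
  exact: measurableT_comp mq measurable_snd.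
have mg1 : measurable_fun setT (fun p : XY => g p.1).
  exact: measurableT_comp mg measurable_fst.
have a0 : (0 <= alpha)%R by exact: ltW.
have icq : nu.-integrable setT (EFin \o (fun p : XY => c p.2 * q p.2)%R).
  apply: (@bounded_integrable _ _ _ nu _ alpha); first exact: measurable_funM.
  by move=> p; exact: normrM_le.
have icr : nu.-integrable setT (EFin \o (fun p : XY => c p.2 * r p.2)%R).
  apply: (@bounded_integrable _ _ _ nu _ alpha); first exact: measurable_funM.
  by move=> p; exact: normrM_le.
have icg : nu.-integrable setT (EFin \o (fun p : XY => c p.2 * g p.1)%R).
  apply: (@bounded_integrable _ _ _ nu _ alpha); first exact: measurable_funM.
  by move=> p; apply: normrM_le => //; exact: gP.1.
have icc : nu.-integrable setT (EFin \o (fun p : XY => c p.2 ^+ 2 / alpha)%R).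
  apply: (@bounded_integrable _ _ _ nu _ alpha).
    by apply: measurable_funM => //; exact: measurable_funX.
  move=> p; rewrite expr2 -mulrA; apply: normrM_le => //.
  by rewrite normrM normfV (ger0_norm a0) ler_pdivrMr// mul1r.
have etaE : \int[mu \x nuY]_p (c p.2 * g (T p))%:E =
    \int[nu]_p (c p.2 * r p.2)%:E.
  rewrite -integral21_prod_meas1; last first.
    apply: (@bounded_integrable _ _ _ (mu \x nuY) (fun p => c p.2 * g (T p))%R alpha).
      exact: measurable_funM.
    by move=> p; apply: normrM_le => //; exact: gP.1.
  rewrite -(@bounded_integral_image_law _ _ _ _ _ nu _ measurable_snd
      (fun y => c y * r y)%R alpha)//; last 2 first.
  - exact: measurable_funM.
  - by move=> y; exact: normrM_le.
  apply: eq_integral => y _; rewrite /fubini_G/= EFinM.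
  rewrite (@EFin_Rintegral _ _ _ _ _ 1)//; last by move=> x; exact: gP.1.
  rewrite -integralZl//.
  by apply: (@bounded_integrable _ _ _ mu _ 1) => // x; exact: gP.1.
rewrite etaE integralB_EFin// (q_cond mc c_le).
have -> : \int[nu]_p (c p.2 * q p.2)%:E - \int[nu]_p (c p.2 ^+ 2 / alpha)%:E -
    \int[nu]_p (c p.2 * r p.2)%:E =
  \int[nu]_p ((c p.2 * q p.2 - c p.2 ^+ 2 / alpha) - c p.2 * r p.2)%:E.
  have icqc : nu.-integrable setT
      (EFin \o (fun p : XY => c p.2 * q p.2 - c p.2 ^+ 2 / alpha)%R).
    exact: (integrableB measurableT icq icc).
  by rewrite -integralB_EFin// -(integralB_EFin measurableT icqc icr).
rewrite -ge0_integralZl//; last 3 first.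
- apply/measurable_EFinP; apply: measurable_funX; exact: measurable_funB.
- by move=> p _; rewrite lee_fin sqr_ge0.
- by rewrite lee_fin divr_ge0.
apply: le_integral_pointwise => p; rewrite -EFinM lee_fin /c.
rewrite le_eqVlt; apply/orP; left; apply/eqP; field.
by rewrite gt_eqF.
Qed.

End gap_mean_square.

(** * Measures on products and densities *)

Section product_uniqueness.
Local Open Scope ereal_scope.
Variable R : realType.

(** Rectangles form a pi-system that generates the product sigma-algebra. *)
Lemma eq_measure_prod d1 d2 (T1 : measurableType d1) (T2 : measurableType d2)
    (m1 m2 : {measure set (T1 * T2) -> \bar R}) :
  m1 setT < +oo ->
  (forall A B, measurable A -> measurable B -> m1 (A `*` B) = m2 (A `*` B)) ->
  forall S, measurable S -> m1 S = m2 S.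
Proof.
move=> m1T m12.
pose G : set (set (T1 * T2)) :=
  [set C | exists A, measurable A /\ exists B, measurable B /\ C = A `*` B].
have GI : setI_closed G.
  move=> /= _ _ [X1 [mX1 [X2 [mX2 ->]]]] [Y1 [mY1 [Y2 [mY2 ->]]]].
  rewrite -setXI; exists (X1 `&` Y1); split; first exact: measurableI.
  by exists (X2 `&` Y2); split => //; exact: measurableI.
apply: (measure_unique G (fun=> setT)) => //.
- rewrite measurable_prod_measurableType //; congr (<<s _ >>).
  rewrite predeqE; split => [[A mA [B mB <-]]|[A [mA [B [mB ->]]]]].
    by exists A; split => //; exists B.
  by exists A => //; exists B.
- by move=> _; exists setT; split => //; exists setT; split => //; rewrite setXTT.
- by rewrite bigcup_const//; exists 0%N.
- by move=> _ [A [mA [B [mB ->]]]]; exact: m12.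
Qed.

(** For a fixed first side, the two slices are measures on a product of two
    spaces that agree on rectangles. *)
Lemma eq_measure_prod3 d1 d2 d3 (T1 : measurableType d1)
    (T2 : measurableType d2) (T3 : measurableType d3)
    (m1 m2 : {measure set (T1 * (T2 * T3)) -> \bar R}) :
  m1 setT < +oo ->
  (forall A B C, measurable A -> measurable B -> measurable C ->
    m1 (A `*` (B `*` C)) = m2 (A `*` (B `*` C))) ->
  forall S, measurable S -> m1 S = m2 S.
Proof.
move=> m1T m12; apply: eq_measure_prod => // A W mA mW.
have mAT : measurable (A `*` [set: T2 * T3]) by exact: measurableX.
pose slice (m : {measure set (T1 * (T2 * T3)) -> \bar R}) :
    {measure set (T2 * T3) -> \bar R} :=
  measure_function_pushforward__canonical__measure_function_Measure
    (mrestr m mAT) (@measurable_snd _ _ T1 (T2 * T3)%type).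
have sliceE m V : slice m V = m (A `*` V).
  rewrite /slice/= /pushforward /mrestr; congr (m _).
  by apply/seteqP; split => [[x v]/= [? []]|[x v]/= []].
rewrite -!sliceE; apply: eq_measure_prod => // [|B C mB mC].
  rewrite sliceE; apply: le_lt_trans m1T; apply: le_measure => //;
    by rewrite inE.
by rewrite !sliceE; exact: m12.
Qed.

End product_uniqueness.

Section density.
Local Open Scope ereal_scope.
Context d (T : measurableType d) (R : realType).
Import HBNNSimple.

Lemma integral_density (m m' : {measure set T -> \bar R}) (h : T -> R) :
  measurable_fun setT h -> (forall x, (0 <= h x)%R) ->
  (forall A, measurable A -> m' A = \int[m]_(x in A) (h x)%:E) ->
  forall F, measurable_fun setT F -> (forall x, 0 <= F x) ->
  \int[m']_x F x = \int[m]_x ((h x)%:E * F x).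
Proof.
move=> mh h0 m'E F mF F0.
have mhE : measurable_fun setT (fun x => (h x)%:E) by exact/measurable_EFinP.
have simple (f : {nnsfun T >-> R}) :
    \int[m']_x (f x)%:E = \int[m]_x ((h x)%:E * (f x)%:E).
  transitivity (\int[m']_x (\sum_(r \in range f) (r * \1_(f @^-1` [set r]) x)%:E)).
    by apply: eq_integral => x _; rewrite fimfunE fsumEFin.
  rewrite ge0_integral_fsum//; last 2 first.
  - by move=> r; exact/measurable_EFinP/measurableT_comp.
  - by move=> r x _; rewrite EFinM nnfun_muleindic_ge0.
  transitivity (\int[m]_x
      (\sum_(r \in range f) (h x * (r * \1_(f @^-1` [set r]) x))%:E)); last first.
    apply: eq_integral => x _; rewrite [in RHS]fimfunE -EFinM.
    rewrite fsumEFin//; congr EFin.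
    by rewrite !fsbig_finite//= mulr_sumr.
  rewrite ge0_integral_fsum//; last 2 first.
  - move=> r; apply/measurable_EFinP; apply: measurable_funM => //.
    exact: measurableT_comp.
  - move=> r x _; rewrite EFinM; apply: mule_ge0; first by rewrite lee_fin.
    by rewrite EFinM nnfun_muleindic_ge0.
  apply: eq_fsbigr => r _.
  rewrite integralZl_indic_nnsfun// integral_indic// setIT m'E//.
  have [r0|r0] := ltP r 0%R.
    rewrite preimage_nnfun0// integral_set0 mule0 integral0_eq// => x _.
    by rewrite indic0 mulr0 mulr0.
  rewrite -ge0_integralZl//; last 2 first.
    exact: measurable_funTS.
    by move=> x _; rewrite lee_fin.
  rewrite integral_mkcond; apply: eq_integral => x _.
  rewrite patchE indicE; case: ifPn => _; last by rewrite !mulr0.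
  by rewrite mulr1 -EFinM mulrC.
pose f_ := nnsfun_approx measurableT mF.
have FE x : F x = limn (fun n => (f_ n x)%:E).
  by apply/esym/cvg_lim => //; exact: cvg_nnsfun_approx.
transitivity (\int[m']_x limn (fun n => (f_ n x)%:E)).
  by apply: eq_integral => x _; rewrite FE.
rewrite monotone_convergence//; last 3 first.
- by move=> n; exact/measurable_EFinP.
- by move=> n x _; rewrite lee_fin.
- by move=> x _ a b ab; rewrite lee_fin; exact/lefP/nd_nnsfun_approx.
transitivity (\int[m]_x limn (fun n => (h x)%:E * (f_ n x)%:E)); last first.
  apply: eq_integral => x _; apply/cvg_lim => //; apply: cvgeZl => //.
  exact: cvg_nnsfun_approx.
rewrite monotone_convergence//; last 3 first.
- by move=> n; apply: emeasurable_funM => //; exact/measurable_EFinP.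
- by move=> n x _; rewrite mule_ge0// lee_fin.
- move=> x _ a b ab; apply: lee_wpmul2l; first by rewrite lee_fin.
  by rewrite lee_fin; exact/lefP/nd_nnsfun_approx.
by congr (limn _); apply/funext => n; rewrite simple.
Qed.

End density.

(** * Kernels and disintegration *)

Section kernel_map.
Context d1 d2 (T1 : measurableType d1) (T2 : measurableType d2) (R : realType).
Implicit Types K : T1 -> probability T2 R.

(** Kernels are families of bundled probabilities here, since posteriors and
    filters come in that form. *)
Definition kernel_map K : Prop :=
  forall A, measurable A -> measurable_fun setT (fun x => K x A).

Lemma kernel_mapP K :
  kernel_map K <-> measurable_fun setT (K : T1 -> pprobability T2 R).
Proof.
split=> [mK|mK A mA]; last exact: (measurable_kernel (kprobability mK) A mA).
apply: (measurability (@pset _ _ _ : set (set (pprobability T2 R)))) => //.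
move=> _ -[_ [r r01] [A mA <-]] <-.
by apply: emeasurable_fun_infty_o => //; exact: mK.
Qed.

Local Open Scope ereal_scope.

Lemma measurable_kernel_integral K (F : T1 * T2 -> \bar R) : kernel_map K ->
  (forall p, 0 <= F p) -> measurable_fun setT F ->
  measurable_fun setT (fun x => \int[K x]_y F (x, y)).
Proof.
move=> /kernel_mapP mK F0 mF.
exact: (measurable_fun_integral_finite_kernel F (kprobability mK)).
Qed.

Lemma measurable_kernel_Rintegral K (f : T1 * T2 -> R) (M : R) :
  kernel_map K -> measurable_fun setT f -> (forall p, `|f p| <= M)%R ->
  measurable_fun setT (fun x => \int[K x]_y f (x, y))%R.
Proof.
move=> mK mf fM.
(* the translation by [M] makes the integrand nonnegative *)
have mfM : measurable_fun setT (fun p => (f p + M)%:E).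
  by apply/measurable_EFinP; exact: measurable_funD.
have fM0 p : 0 <= (f p + M)%:E.
  by rewrite lee_fin; have := fM p; rewrite ler_norml; lra.
have mint := measurable_kernel_integral mK fM0 mfM.
have -> : (fun x => \int[K x]_y f (x, y))%R =
    (fun x => fine (\int[K x]_y (f (x, y) + M)%:E) - M)%R.
  apply/funext => x.
  have mfx : measurable_fun setT (fun y => f (x, y)).
    exact: measurableT_comp mf (measurable_pair1 x).
  rewrite -[X in (X - _)%R]/(\int[K x]_y (f (x, y) + M))%R RintegralD//.
  - have -> : (\int[K x]_y M)%R = M.
      rewrite Rintegral_cst//.
      apply: (etrans (congr1 (fun u => M * fine u)%R (probability_setT (K x)))).
      by rewrite mulr1.
    by rewrite addrK.
  - by apply: (@bounded_integrable _ _ _ (K x) _ M) => // y; exact: fM.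
  - by apply: (@bounded_integrable _ _ _ (K x) (fun=> M) `|M|%R).
apply: measurable_funB => //.
by apply: measurableT_comp mint; exact: fine_measurable.
Qed.

End kernel_map.

Lemma kernel_map_comp d0 d1 d2 (T0 : measurableType d0) (T1 : measurableType d1)
    (T2 : measurableType d2) (R : realType) (K : T1 -> probability T2 R)
    (f : T0 -> T1) :
  measurable_fun setT f -> kernel_map K -> kernel_map (fun x => K (f x)).
Proof. by move=> mf mK A mA; exact: measurableT_comp (mK A mA) mf. Qed.

Lemma kernel_map_cst d1 d2 (T1 : measurableType d1) (T2 : measurableType d2)
    (R : realType) (Q : probability T2 R) : kernel_map (fun _ : T1 => Q).
Proof. by move=> A mA; exact: measurable_cst. Qed.

Section bind.
Context d1 d2 (T1 : measurableType d1) (T2 : measurableType d2) (R : realType).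
Variables (P : probability T1 R) (K : T1 -> probability T2 R).
Hypothesis mK : kernel_map K.
Local Open Scope ereal_scope.

Definition bind_measure (A : set T2) : \bar R := \int[P]_x K x A.

Let bind0 : bind_measure set0 = 0.
Proof. by rewrite /bind_measure integral0_eq. Qed.

Let bind_ge0 A : 0 <= bind_measure A.
Proof. exact: integral_ge0. Qed.

Let bind_sigma_additive : semi_sigma_additive bind_measure.
Proof.
move=> U mU tU mUU; rewrite [X in _ --> X](_ : _ =
  \int[P]_x (\sum_(k <oo) K x (U k))); last first.
  by apply: eq_integral => x _; exact/esym/cvg_lim/measure_semi_sigma_additive.
apply/cvg_closeP; split.
  by apply: is_cvg_nneseries => k _ _; exact: integral_ge0.
rewrite closeE// integral_nneseries// => k.
exact: mK.
Qed.

HB.instance Definition _ := isMeasure.Build _ _ _ bind_measure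
  bind0 bind_ge0 bind_sigma_additive.

Let bind_setT : bind_measure setT = 1.
Proof.
rewrite /bind_measure (eq_integral (cst 1)); last first.
  by move=> x _; exact: probability_setT.
have PT : P setT = 1 by exact: probability_setT.
by rewrite integral_cst// mul1e.
Qed.

HB.instance Definition _ :=
  Measure_isProbability.Build _ _ _ bind_measure bind_setT.

Definition bind : probability T2 R := bind_measure.

Lemma integral_mixture (m : {measure set T2 -> \bar R}) :
  (forall A, measurable A -> m A = \int[P]_x K x A) ->
  forall F, measurable_fun setT F -> (forall y, 0 <= F y) ->
  \int[m]_y F y = \int[P]_x \int[K x]_y F y.
Proof.
move=> mE F mF F0.
have /kernel_mapP mK1 : kernel_map (fun p : unit * T1 => K p.2).
  exact: kernel_map_comp measurable_snd mK.
have mP : measurable_fun setT (fun _ : unit => P : pprobability T1 R).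
  exact: measurable_cst.
rewrite -(integral_kcomp (kprobability mP) (kprobability mK1) tt F0 mF).
by apply: eq_measure_integral => A mA _; rewrite mE.
Qed.

End bind.

Section graph_kernel.
Context d d1 d2 (T : measurableType d) (T1 : measurableType d1)
  (T2 : measurableType d2) (R : realType).
Variables (Z : T -> T1) (K : T -> probability T2 R).
Hypotheses (mZ : measurable_fun setT Z) (mK : kernel_map K).

(** Attaching [Z t] to the sampled point turns functions of the pair into
    functions of a single variable. *)
Definition graph_kernel (t : T) : probability (T1 * T2)%type R :=
  image_law (K t) (measurable_pair1 (T1 := T1) (T2 := T2) (Z t)).

Lemma kernel_map_graph : kernel_map graph_kernel.
Proof.
move=> S mS.
have mZK : measurable_fun setT (fun p : T * T2 => (Z p.1, p.2)).
  apply: measurable_fun_pair; last exact: measurable_snd.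
  exact: measurableT_comp mZ measurable_fst.
have := measurable_kernel_integral mK (F := fun p => (\1_S (Z p.1, p.2))%:E).
have -> : (fun t => \int[K t]_y (\1_S (Z (t, y).1, (t, y).2))%:E)%E =
    (fun t => graph_kernel t S).
  apply/funext => t; rewrite /graph_kernel image_lawE.
  rewrite -[in RHS](setIT (_ @^-1` S)) -integral_indic//.
  rewrite -[X in measurable X]setTI.
  exact: (measurable_pair1 (Z t)).
apply => [p|]; first by rewrite lee_fin.
by apply/measurable_EFinP; exact: (measurableT_comp _ mZK).
Qed.

Local Open Scope ereal_scope.

Lemma integral_graph_kernel t (F : T1 * T2 -> \bar R) :
  measurable_fun setT F -> (forall p, 0 <= F p) ->
  \int[graph_kernel t]_p F p = \int[K t]_y F (Z t, y).
Proof. by move=> mF F0; rewrite ge0_integral_image_law. Qed.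

Lemma graph_kernelE t A B : measurable A -> measurable B ->
  graph_kernel t (A `*` B) = (\1_A (Z t))%:E * K t B.
Proof.
move=> mA mB; rewrite /graph_kernel image_lawE indicE.
have [ZA|ZA] := boolP (Z t \in A).
  rewrite mul1e; congr (K t _); apply/seteqP; split => [y []//|y By].
  by split => //=; exact: set_mem.
rewrite mul0e -(measure0 (K t)); congr (K t _).
by rewrite -subset0 => y [/= /mem_set]; rewrite (negPf ZA).
Qed.

End graph_kernel.

Section joint_law.
Context d (Omega : measurableType d) (R : realType) (P : probability Omega R).
Context d1 (E : measurableType d1).
Variable Z : Omega -> E.
Hypothesis mZ : measurable_fun setT Z.
Local Open Scope ereal_scope.

Let integral_rectangle d2 (F : measurableType d2) (K : Omega -> probability F R)
    A B : kernel_map K -> measurable A -> measurable B ->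
  \int[P]_o graph_kernel Z K o (A `*` B) = \int[P]_(o in Z @^-1` A) K o B.
Proof.
move=> mK mA mB.
rewrite [RHS]integral_mkcond; apply: eq_integral => o _.
rewrite graph_kernelE// patchE indicE.
have -> : (o \in Z @^-1` A) = (Z o \in A) by apply/idP/idP; rewrite !inE.
by case: ifPn => _; rewrite ?mul1e ?mul0e.
Qed.

(** The law of [(Z, V)] and the mixture of the graphs of [K] are two measures on
    a product, so that they agree as soon as they agree on rectangles. *)
Lemma joint_law_kernel d2 (F : measurableType d2) (V : Omega -> F)
    (K : Omega -> probability F R) :
  measurable_fun setT V -> kernel_map K ->
  (forall A B, measurable A -> measurable B ->
    P (Z @^-1` A `&` V @^-1` B) = \int[P]_(o in Z @^-1` A) K o B) ->
  forall f : E * F -> \bar R, measurable_fun setT f -> (forall p, 0 <= f p) ->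
  \int[P]_o f (Z o, V o) = \int[P]_o \int[K o]_v f (Z o, v).
Proof.
move=> mV mK PK f mf f0.
have mZV := measurable_fun_pair mZ mV.
rewrite -(ge0_integral_image_law P mZV)//.
rewrite (integral_mixture (P := P) (kernel_map_graph mZ mK))//.
  by apply: eq_integral => o _; rewrite integral_graph_kernel.
move=> S mS; rewrite -[RHS]/(bind P (kernel_map_graph mZ mK) S).
apply: eq_measure_prod => //.
  by apply: (le_lt_trans (probability_le1 _ measurableT)); rewrite ltry.
move=> A B mA mB; rewrite [RHS]integral_rectangle// -PK//.
Qed.

Lemma joint_law_kernel3 d2 d3 (F1 : measurableType d2) (F2 : measurableType d3)
    (V : Omega -> F1 * F2) (K : Omega -> probability (F1 * F2)%type R) :
  measurable_fun setT V -> kernel_map K ->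
  (forall A B C, measurable A -> measurable B -> measurable C ->
    P (Z @^-1` A `&` V @^-1` (B `*` C)) =
    \int[P]_(o in Z @^-1` A) K o (B `*` C)) ->
  forall f : E * (F1 * F2) -> \bar R,
  measurable_fun setT f -> (forall p, 0 <= f p) ->
  \int[P]_o f (Z o, V o) = \int[P]_o \int[K o]_v f (Z o, v).
Proof.
move=> mV mK PK; apply: joint_law_kernel => // A W mA mW.
have mZV := measurable_fun_pair mZ mV.
rewrite -integral_rectangle//.
rewrite -[RHS]/(bind P (kernel_map_graph mZ mK) (A `*` W)).
rewrite -[LHS]/(image_law P mZV (A `*` W)).
apply: eq_measure_prod3 => //; last exact: measurableX.
  by apply: (le_lt_trans (probability_le1 _ measurableT)); rewrite ltry.
move=> A' B C mA' mB mC; rewrite [RHS]integral_rectangle//; last exact: measurableX.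
exact: PK.
Qed.

End joint_law.

(** * The kernels of the model and of the filter *)

Section model_kernels.
Context {R : realType} {n m : nat}
  {kappa : {sigma_finite_measure set 'rV[R]_m -> \bar R}}.
Variable mdl : ssm n kappa.
Local Open Scope ereal_scope.

Lemma measurable_lik_y t x : measurable_fun setT (fun y => lik mdl t y x).
Proof. exact: (measurableT_comp (measurable_lik mdl t) (measurable_pair2 x)). Qed.

Lemma measurable_lik_x t y : measurable_fun setT (fun x => lik mdl t y x).
Proof. exact: (measurableT_comp (measurable_lik mdl t) (measurable_pair1 y)). Qed.

#[local] Hint Resolve measurable_lik_x measurable_lik_y : core.

Section emission.
Variables (t : nat) (x : 'rV[R]_n).

Definition emission_measure (A : set 'rV[R]_m) : \bar R :=
  \int[kappa]_(y in A) (lik mdl t y x)%:E.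

Let emission0 : emission_measure set0 = 0.
Proof. by rewrite /emission_measure integral_set0. Qed.

Let emission_ge0 A : 0 <= emission_measure A.
Proof. by apply: integral_ge0 => y _; rewrite lee_fin lik_ge0. Qed.

Let emission_sigma_additive : semi_sigma_additive emission_measure.
Proof.
apply: semi_sigma_additive_nng_induced => [|y]; last by rewrite lee_fin lik_ge0.
exact/measurable_EFinP.
Qed.

HB.instance Definition _ := isMeasure.Build _ _ _ emission_measure
  emission0 emission_ge0 emission_sigma_additive.

Let emission_setT : emission_measure setT = 1.
Proof. exact: lik_mass. Qed.

HB.instance Definition _ :=
  Measure_isProbability.Build _ _ _ emission_measure emission_setT.

Definition emission : probability 'rV[R]_m R := emission_measure.

Lemma integral_emission (F : 'rV[R]_m -> \bar R) :
  measurable_fun setT F -> (forall y, 0 <= F y) ->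
  \int[emission]_y F y = \int[kappa]_y ((lik mdl t y x)%:E * F y).
Proof. by move=> mF F0; apply: integral_density => // y; exact: lik_ge0. Qed.

End emission.

Lemma kernel_map_emission t : kernel_map (emission t).
Proof.
move=> A mA.
pose F (p : 'rV[R]_n * 'rV[R]_m) := ((lik mdl t p.2 p.1)%:E * (\1_A p.2)%:E).
have mF : measurable_fun setT F.
  apply: emeasurable_funM; apply/measurable_EFinP.
    exact: (measurableT_comp (measurable_lik mdl t)
      (measurable_fun_pair measurable_snd measurable_fst)).
  by apply: measurableT_comp measurable_snd.
have F0 p : 0 <= F p by rewrite mule_ge0 ?lee_fin// lik_ge0.
have := measurable_fun_fubini_tonelli_F (m2 := kappa) F mF F0.
suff -> : fubini_F kappa F = (fun x => emission t x A) by [].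
apply/funext => x; rewrite /fubini_F -(setIT A) -integral_indic//.
by rewrite integral_emission//; exact/measurable_EFinP.
Qed.

Section transition.
Variables (t : nat) (x : 'rV[R]_n).

Definition transition_measure (A : set 'rV[R]_n) : \bar R := trans mdl t x A.

HB.instance Definition _ := Measure.on transition_measure.

Let transition_setT : transition_measure setT = 1.
Proof. exact: prob_kernel. Qed.

HB.instance Definition _ :=
  Measure_isProbability.Build _ _ _ transition_measure transition_setT.

Definition transition : probability 'rV[R]_n R := transition_measure.

End transition.

Lemma kernel_map_transition t : kernel_map (transition t).
Proof. by move=> A mA; exact: measurable_kernel. Qed.

Lemma integral_predict t (rho : probability 'rV[R]_n R) (F : 'rV[R]_n -> \bar R) :
  measurable_fun setT F -> (forall x, 0 <= F x) ->
  \int[predict mdl t rho]_x F x = \int[rho]_x \int[transition t x]_z F z.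
Proof. by move=> mF F0; apply: (integral_mixture (kernel_map_transition t)). Qed.

Lemma measurable_integral_predict d (T : measurableType d) t
    (K : T -> probability 'rV[R]_n R) (F : T * 'rV[R]_n -> \bar R) :
  kernel_map K -> measurable_fun setT F -> (forall p, 0 <= F p) ->
  measurable_fun setT (fun z => \int[predict mdl t (K z)]_x F (z, x)).
Proof.
move=> mK mF F0.
apply: (measurable_kernel_integral (K := fun z => predict mdl t (K z))) => // A mA.
apply: (measurable_kernel_integral mK (F := fun p => transition t p.2 A)) => //.
exact: measurableT_comp (kernel_map_transition t mA) measurable_snd.
Qed.

Lemma evidence_ge0 t y (rho : probability 'rV[R]_n R) : 0 <= evidence mdl t y rho.
Proof. by apply: integral_ge0 => x _; rewrite lee_fin lik_ge0. Qed.

Lemma integral_reweigh t y (rho : probability 'rV[R]_n R)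
    (F : 'rV[R]_n -> \bar R) : measurable_fun setT F -> (forall x, 0 <= F x) ->
  \int[reweigh mdl t y rho]_x F x = \int[rho]_x ((lik mdl t y x)%:E * F x).
Proof. by move=> mF F0; apply: integral_density => // x; exact: lik_ge0. Qed.

Lemma bayesE t y (rho : probability 'rV[R]_n R) A :
  bayes mdl t y rho A =
  if (evidence mdl t y rho == 0) || (evidence mdl t y rho == +oo) then rho A
  else reweigh mdl t y rho A * (fine (evidence mdl t y rho))^-1%:E.
Proof.
transitivity ((if (evidence mdl t y rho == 0) || (evidence mdl t y rho == +oo)
  then fun U => rho U else
  fun U => reweigh mdl t y rho U * (fine (evidence mdl t y rho))^-1%:E) A) => //.
by case: ifP.
Qed.

(** Bayes' formula in product form, which also holds when the evidence is [0]. *)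
Lemma integral_bayes t y (rho : probability 'rV[R]_n R)
    (F : 'rV[R]_n -> \bar R) : measurable_fun setT F -> (forall x, 0 <= F x) ->
  evidence mdl t y rho < +oo ->
  evidence mdl t y rho * \int[bayes mdl t y rho]_x F x =
  \int[rho]_x ((lik mdl t y x)%:E * F x).
Proof.
move=> mF F0 ey; rewrite -integral_reweigh//.
have e0 := evidence_ge0 t y rho.
have [eE|eN0] := eqVneq (evidence mdl t y rho) 0.
  rewrite eE mul0e; apply/esym.
  transitivity (\int[mzero]_x F x); last exact: integral_measure_zero.
  apply: eq_measure_integral => A mA _; apply/eqP.
  rewrite eq_le measure_ge0 andbT.
  rewrite -[leRHS]/(0%E) -eE; apply: (le_measure (reweigh mdl t y rho)) => //;
    by rewrite inE.
have [r rE] : exists r, evidence mdl t y rho = r%:E.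
  by move: e0 ey; case: (evidence mdl t y rho) => // r _ _; exists r.
have r0 : (0 < r)%R by rewrite -lte_fin -rE lt_def eN0.
have rV0 : (0 <= r^-1)%R by rewrite invr_ge0 ltW.
rewrite (eq_measure_integral (mscale (NngNum rV0) (reweigh mdl t y rho))).
  by rewrite ge0_integral_mscale// rE muleA -EFinM divff ?gt_eqF// mul1e.
move=> A mA _; apply: (etrans (bayesE t y rho A)).
by rewrite rE eqe gt_eqF//= /mscale/= muleC.
Qed.

Lemma kernel_map_filter_step d (T : measurableType d) t
    (K : T -> probability 'rV[R]_n R) : kernel_map K ->
  kernel_map (fun p : 'rV[R]_m * T => filter_step mdl t p.1 (K p.2)).
Proof.
move=> mK A mA.
have mK2 : kernel_map (fun p : 'rV[R]_m * T => K p.2).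
  exact: kernel_map_comp measurable_snd mK.
have mreweigh B : measurable B ->
  measurable_fun setT (fun p : 'rV[R]_m * T =>
    reweigh mdl t p.1 (predict mdl t (K p.2)) B).
  move=> mB.
  pose F (q : ('rV[R]_m * T) * 'rV[R]_n) :=
    (lik mdl t q.1.1 q.2)%:E * (\1_B q.2)%:E.
  have mF : measurable_fun setT F.
    apply: emeasurable_funM; apply/measurable_EFinP.
      exact: (measurableT_comp (measurable_lik mdl t) (measurable_fun_pair
        (measurableT_comp measurable_fst measurable_fst) measurable_snd)).
    by apply: measurableT_comp measurable_snd.
  have F0 q : 0 <= F q by rewrite mule_ge0 ?lee_fin// lik_ge0.
  have := measurable_integral_predict t mK2 mF F0.
  apply: eq_measurable_fun => p _; rewrite -[in RHS](setIT B) -integral_indic//.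
  by rewrite integral_reweigh//; exact/measurable_EFinP.
pose e (p : 'rV[R]_m * T) := evidence mdl t p.1 (predict mdl t (K p.2)).
have me : measurable_fun setT e by exact: mreweigh.
rewrite /filter_step /bayes.
(* the inverse is written as a power, which is measurable on the whole line *)
rewrite (_ : (fun p => _) = fun p => if (e p == 0) || (e p == +oo)
  then predict mdl t (K p.2) A
  else reweigh mdl t p.1 (predict mdl t (K p.2)) A *
       ((fine (e p)) `^ (-1))%R%:E); last first.
  apply/funext => p; rewrite bayesE -/(e p); case: ifPn => // _.
  by rewrite powR_inv1// fine_ge0//; exact: evidence_ge0.
apply: measurable_fun_ifT.
- apply: (measurable_fun_bool true); rewrite setTI.
  rewrite (_ : _ @^-1` _ = e @^-1` [set 0] `|` e @^-1` [set +oo]).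
    by apply: measurableU; rewrite -[X in measurable X]setTI; exact: me.
  by apply/seteqP; split => p /=; [move=> /orP[/eqP|/eqP]|move=> []->];
    rewrite ?eqxx ?orbT//; [left|right].
- apply: (measurable_kernel_integral mK2 (F := fun q => transition t q.2 A)) => //.
  exact: measurableT_comp (kernel_map_transition t mA) measurable_snd.
- apply: emeasurable_funM; first exact: mreweigh.
  apply/measurable_EFinP; apply: (measurableT_comp (measurable_powR (-1)%R)).
  by apply: measurableT_comp me; exact: fine_measurable.
Qed.

Section next_integral.
Context d1 (E : measurableType d1).
Variables (t : nat) (F : E * ('rV[R]_n * 'rV[R]_m) -> \bar R).
Hypotheses (mF : measurable_fun setT F) (F0 : forall p, 0 <= F p).

(** The conditional mean of a function of the past, the next state and the next
    observation, given the past [p.1] and the present state [p.2]. *)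
Definition next_integral (p : E * 'rV[R]_n) : \bar R :=
  \int[transition t.+1 p.2]_x \int[kappa]_y
    ((lik mdl t.+1 y x)%:E * F (p.1, (x, y))).

Lemma measurable_lik_mul :
  measurable_fun setT (fun p => (lik mdl t.+1 p.2.2 p.2.1)%:E * F p).
Proof.
apply: emeasurable_funM => //; apply/measurable_EFinP.
exact: (measurableT_comp (measurable_lik mdl t.+1) (measurable_fun_pair
  (measurableT_comp measurable_snd measurable_snd)
  (measurableT_comp measurable_fst measurable_snd))).
Qed.

Lemma lik_mul_ge0 p : 0 <= (lik mdl t.+1 p.2.2 p.2.1)%:E * F p.
Proof. by rewrite mule_ge0// lee_fin lik_ge0. Qed.

Lemma next_integral_ge0 p : 0 <= next_integral p.
Proof.
apply: integral_ge0 => x _; apply: integral_ge0 => y _.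
exact: (lik_mul_ge0 (p.1, (x, y))).
Qed.

Lemma measurable_next_integral : measurable_fun setT next_integral.
Proof.
pose L (p : (E * 'rV[R]_n) * 'rV[R]_m) :=
  (lik mdl t.+1 p.2 p.1.2)%:E * F (p.1.1, (p.1.2, p.2)).
have mL : measurable_fun setT L.
  apply: (measurableT_comp measurable_lik_mul
    (g := fun p : (E * 'rV[R]_n) * 'rV[R]_m => (p.1.1, (p.1.2, p.2)))).
  apply: measurable_fun_pair.
    exact: (measurableT_comp measurable_fst measurable_fst).
  apply: measurable_fun_pair; last exact: measurable_snd.
  exact: (measurableT_comp measurable_snd measurable_fst).
have L0 p : 0 <= L p by exact: (lik_mul_ge0 (p.1.1, (p.1.2, p.2))).
pose G (p : E * 'rV[R]_n) := \int[kappa]_y L (p, y).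
have mG : measurable_fun setT G.
  exact: (measurable_fun_fubini_tonelli_F (m2 := kappa) L mL L0).
have G0 p : 0 <= G p by apply: integral_ge0 => y _.
have mT : kernel_map (fun p : E * 'rV[R]_n => transition t.+1 p.2).
  exact: kernel_map_comp measurable_snd (kernel_map_transition _).
pose GG (q : (E * 'rV[R]_n) * 'rV[R]_n) := G (q.1.1, q.2).
have mGG : measurable_fun setT GG.
  exact: (measurableT_comp mG (measurable_fun_pair
    (measurableT_comp measurable_fst measurable_fst) measurable_snd)).
by apply: (measurable_kernel_integral mT _ mGG) => q; exact: G0.
Qed.

End next_integral.

End model_kernels.

(** * One step of the process *)

Section observations.
Context d (Omega : measurableType d) {R : realType} (P : probability Omega R)
  {n m : nat}.
Variables (X : nat -> {RV P >-> 'rV[R]_n}) (Y : nat -> {RV P >-> 'rV[R]_m}).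

Lemma measurable_obs t l : measurable_fun setT (obs Y t l).
Proof.
apply/measurable_fun_tnthP => i.
rewrite (_ : _ \o _ = Y (t - i)%N); first exact: measurable_funPT.
by apply/funext => o /=; rewrite tnth_mktuple.
Qed.

Lemma obs_cons t l o : obs Y t.+1 l.+1 o = [tuple of Y t.+1 o :: obs Y t l o].
Proof.
apply: eq_from_tnth => i; rewrite tnth_mktuple.
by case: (unliftP ord0 i) => [j|] ->; rewrite ?tnthS ?tnth_mktuple.
Qed.

(** The model is specified through events of the full history; the windows of
    observations generate some of them. *)
Lemma obs_history t l B : (l <= t)%N -> measurable B ->
  exists2 G, measurable G & obs Y t l @^-1` B = history X Y t @^-1` G.
Proof.
move=> lt mB.
pose recent (h : t.+1.-tuple 'rV[R]_n * t.-tuple 'rV[R]_m) : l.-tuple 'rV[R]_m :=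
  [tuple tnth h.2 (widen_ord lt i) | i < l].
have mrecent : measurable_fun setT recent.
  apply/measurable_fun_tnthP => i.
  rewrite (_ : _ \o _ = fun h => tnth h.2 (widen_ord lt i)).
    exact: measurableT_comp (measurable_tnth _) measurable_snd.
  by apply/funext => h /=; rewrite tnth_mktuple.
exists (recent @^-1` B); first by rewrite -[X in measurable X]setTI; exact: mrecent.
suff -> : obs Y t l = recent \o history X Y t by [].
by apply/funext => o /=; apply: eq_from_tnth => i; rewrite !tnth_mktuple.
Qed.

Lemma measurable_history t : measurable_fun setT (history X Y t).
Proof.
apply: measurable_fun_pair; last exact: measurable_obs.
apply/measurable_fun_tnthP => i.
rewrite (_ : _ \o _ = X i); first exact: measurable_funPT.
by apply/funext => o /=; rewrite tnth_mktuple.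
Qed.

End observations.
Arguments measurable_obs {d Omega R P m} Y t l.

Section prepend.
Context {R : realType} {n m l : nat} (F : l.+1.-tuple 'rV[R]_m * 'rV[R]_n -> \bar R).

Definition prepend (q : l.-tuple 'rV[R]_m * ('rV[R]_n * 'rV[R]_m)) : \bar R :=
  F ([tuple of q.2.2 :: q.1], q.2.1).

Lemma measurable_prepend : measurable_fun setT F -> measurable_fun setT prepend.
Proof.
move=> mF.
have mcons : measurable_fun setT
    (fun q : l.-tuple 'rV[R]_m * ('rV[R]_n * 'rV[R]_m) =>
      [tuple of q.2.2 :: q.1] : l.+1.-tuple 'rV[R]_m).
  exact: (measurable_cons (measurableT_comp measurable_snd measurable_snd)
    measurable_fst).
exact: (measurableT_comp mF (measurable_fun_pair mcons
  (measurableT_comp measurable_fst measurable_snd))).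
Qed.

End prepend.

Section model_step.
Context d (Omega : measurableType d) {R : realType} (P : probability Omega R)
  {n m : nat} {kappa : {sigma_finite_measure set 'rV[R]_m -> \bar R}}.
Variables (X : nat -> {RV P >-> 'rV[R]_n}) (Y : nat -> {RV P >-> 'rV[R]_m}).
Variables (mdl : ssm n kappa) (mu0 : probability 'rV[R]_n R) (N : nat).
Hypothesis XY_gen : generated_by X Y mdl mu0 N.
Local Open Scope ereal_scope.

Let next t o : probability ('rV[R]_n * 'rV[R]_m)%type R :=
  bind (transition mdl t.+1 (X t o))
    (kernel_map_graph (@measurable_id _ _ setT) (kernel_map_emission mdl t.+1)).

Let kernel_map_next t : kernel_map (next t).
Proof.
move=> S mS.
have mXt : kernel_map (fun o => transition mdl t.+1 (X t o)).
  exact: kernel_map_comp (measurable_funPT (X t)) (kernel_map_transition _ _).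
pose F (p : Omega * 'rV[R]_n) := graph_kernel id (emission mdl t.+1) p.2 S.
have mF : measurable_fun setT F.
  exact: (measurableT_comp (kernel_map_graph (@measurable_id _ _ setT)
    (kernel_map_emission mdl t.+1) mS) measurable_snd).
by apply: (measurable_kernel_integral mXt _ mF) => p; exact: measure_ge0.
Qed.

Lemma integral_next t o (F : 'rV[R]_n * 'rV[R]_m -> \bar R) :
  measurable_fun setT F -> (forall p, 0 <= F p) ->
  \int[next t o]_p F p = \int[transition mdl t.+1 (X t o)]_x
    \int[kappa]_y ((lik mdl t.+1 y x)%:E * F (x, y)).
Proof.
move=> mF F0.
rewrite (integral_mixture (P := transition mdl t.+1 (X t o))
  (kernel_map_graph (@measurable_id _ _ setT) (kernel_map_emission mdl t.+1)))//.
apply: eq_integral => x _; rewrite integral_graph_kernel// integral_emission//.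
exact: (measurableT_comp mF (measurable_pair1 x)).
Qed.

(** The Markov property, for functions instead of events. *)
Lemma model_step t l (F : l.-tuple 'rV[R]_m * ('rV[R]_n * 'rV[R]_m) -> \bar R) :
  (t < N)%N -> (l <= t)%N -> measurable_fun setT F -> (forall p, 0 <= F p) ->
  \int[P]_o F (obs Y t l o, (X t.+1 o, Y t.+1 o)) =
  \int[P]_o next_integral mdl t F (obs Y t l o, X t o).
Proof.
move=> tN lt mF F0.
have mXY : measurable_fun setT (fun o => (X t.+1 o, Y t.+1 o)).
  by apply: measurable_fun_pair; exact: measurable_funPT.
rewrite (joint_law_kernel3 (measurable_obs Y t l) mXY (kernel_map_next t))//.
  apply: eq_integral => o _; rewrite integral_next//.
  exact: (measurableT_comp mF (measurable_pair1 _)).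
move=> A B C mA mB mC.
have [G mG AG] := obs_history X Y lt mA.
have := XY_gen.2 t tN G B C mG mB mC.
rewrite -AG => PE.
transitivity (P (obs Y t l @^-1` A `&` X t.+1 @^-1` B `&` Y t.+1 @^-1` C)).
  by rewrite -setIA.
rewrite PE; apply: eq_integral => o _.
rewrite integral_mkcond /= /next /bind/= /bind_measure.
apply: eq_integral => x _; rewrite graph_kernelE// patchE indicE.
by case: ifPn => _; rewrite ?mul1e ?mul0e.
Qed.

End model_step.

(** * Versions of the conditional law of the state *)

Section filter_version.
Context d (Omega : measurableType d) {R : realType} (P : probability Omega R)
  {n m : nat} {kappa : {sigma_finite_measure set 'rV[R]_m -> \bar R}}.
Variables (X : nat -> {RV P >-> 'rV[R]_n}) (Y : nat -> {RV P >-> 'rV[R]_m}).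
Local Open Scope ereal_scope.

(** [rho] is a regular conditional law of [X t] given the last [l] observations:
    it is a function of them and disintegrates the joint law. The posterior is
    the case [l = t]; the filter restarted at time [s] is the case [l = t - s]. *)
Definition filter_version t l (rho : Omega -> probability 'rV[R]_n R) : Prop :=
  exists k : l.-tuple 'rV[R]_m -> probability 'rV[R]_n R,
  [/\ kernel_map k, forall o, rho o = k (obs Y t l o) &
  forall F : l.-tuple 'rV[R]_m * 'rV[R]_n -> \bar R,
    measurable_fun setT F -> (forall p, 0 <= F p) ->
    \int[P]_o F (obs Y t l o, X t o) =
    \int[P]_o \int[k (obs Y t l o)]_x F (obs Y t l o, x)].

Lemma filter_version_random t l rho : filter_version t l rho ->
  random_probability rho.
Proof.
move=> [k [mk rhoE _]]; apply/kernel_mapP => A mA.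
under eq_fun do rewrite rhoE.
exact: measurableT_comp (mk A mA) (measurable_obs Y t l).
Qed.

Lemma posterior_version t (pi : t.-tuple _ -> _) : posterior X Y pi ->
  filter_version t t (fun o => pi (obs Y t t o)).
Proof.
move=> [/kernel_mapP mpi piE]; exists pi; split => // F mF F0.
have mK : kernel_map (fun o => pi (obs Y t t o)).
  exact: kernel_map_comp (measurable_obs Y t t) mpi.
apply: (joint_law_kernel (measurable_obs Y t t) (measurable_funPT (X t)) mK) => //.
by move=> A B mA mB; rewrite setIC; exact: piE.
Qed.

(** A law that starts the filter at time [t] before any observation is seen. *)
Lemma prior_version t (mu : probability 'rV[R]_n R) :
  (forall A, measurable A -> P (X t @^-1` A) = mu A) ->
  filter_version t 0 (fun=> mu).
Proof.
move=> XE; exists (fun=> mu); split => // F mF F0.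
have mK : kernel_map (fun _ : Omega => mu) by exact: kernel_map_cst.
apply: (joint_law_kernel (measurable_obs Y t 0) (measurable_funPT (X t)) mK) => //.
move=> A B mA mB.
have [A0|A0] := pselect (A [tuple]).
  have -> : obs Y t 0 @^-1` A = setT.
    by apply/seteqP; split => // o _ /=; rewrite (tuple0 (obs Y t 0 o)).
  have PT : P setT = 1 by exact: probability_setT.
  by rewrite setTI XE// integral_cst//= PT mule1.
have -> : obs Y t 0 @^-1` A = set0.
  by rewrite -subset0 => o /=; rewrite (tuple0 (obs Y t 0 o)).
by rewrite set0I measure0 integral_set0.
Qed.

Variables (mdl : ssm n kappa) (mu0 : probability 'rV[R]_n R) (N : nat).
Hypothesis XY_gen : generated_by X Y mdl mu0 N.

Section step.
Variables (t l : nat) (k : l.-tuple 'rV[R]_m -> probability 'rV[R]_n R).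
Hypotheses (tN : (t < N)%N) (lt : (l <= t)%N) (mk : kernel_map k)
  (k_cond : forall F : l.-tuple 'rV[R]_m * 'rV[R]_n -> \bar R,
    measurable_fun setT F -> (forall p, 0 <= F p) ->
    \int[P]_o F (obs Y t l o, X t o) =
    \int[P]_o \int[k (obs Y t l o)]_x F (obs Y t l o, x)).
Local Notation Obs := (l.-tuple 'rV[R]_m).
Local Notation Z := (obs Y t l).

Let e (z : Obs) y := evidence mdl t.+1 y (predict mdl t.+1 (k z)).

(** The present state is first averaged over its conditional law [k], then the
    integrals over the next state and the next observation are exchanged. *)
Let step_formula (F : Obs * ('rV[R]_n * 'rV[R]_m) -> \bar R) :
  measurable_fun setT F -> (forall p, 0 <= F p) ->
  \int[P]_o F (Z o, (X t.+1 o, Y t.+1 o)) =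
  \int[P]_o \int[kappa]_y \int[predict mdl t.+1 (k (Z o))]_x
    ((lik mdl t.+1 y x)%:E * F (Z o, (x, y))).
Proof.
move=> mF F0; rewrite (model_step XY_gen tN lt mF F0).
rewrite (k_cond (measurable_next_integral mdl t mF F0)); last first.
  by move=> p; exact: next_integral_ge0.
apply: eq_integral => o _.
pose L (p : 'rV[R]_n * 'rV[R]_m) := (lik mdl t.+1 p.2 p.1)%:E * F (Z o, p).
have mL : measurable_fun setT L.
  exact: (measurableT_comp (measurable_lik_mul mdl t mF) (measurable_pair1 (Z o))).
have L0 p : 0 <= L p by exact: (lik_mul_ge0 mdl t F0 (Z o, p)).
have mG := measurable_fun_fubini_tonelli_F (m2 := kappa) L mL L0.
rewrite -[LHS](integral_predict mdl t.+1 (k (Z o)) mG)//.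
  exact: (fubini_tonelli (m1 := predict mdl t.+1 (k (Z o))) L mL L0).
by move=> x; exact: integral_ge0.
Qed.

(** The evidence is a probability density in [y], hence finite almost
    everywhere. *)
Let ae_evidence_lty z : {ae kappa, forall y, e z y < +oo}.
Proof.
pose L (p : 'rV[R]_n * 'rV[R]_m) := (lik mdl t.+1 p.2 p.1)%:E.
have mL : measurable_fun setT L.
  apply/measurable_EFinP; exact: (measurableT_comp (measurable_lik mdl t.+1)
    (measurable_fun_pair measurable_snd measurable_fst)).
have L0 p : 0 <= L p by rewrite lee_fin lik_ge0.
have me : measurable_fun setT (e z).
  exact: (measurable_fun_fubini_tonelli_G (m1 := predict mdl t.+1 (k z)) L mL L0).
have e1 : \int[kappa]_y e z y = 1.
  rewrite -(fubini_tonelli (m1 := predict mdl t.+1 (k z)) L mL L0).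
  rewrite (eq_integral (cst 1)); last by move=> x _; exact: lik_mass.
  have PT : predict mdl t.+1 (k z) setT = 1 by exact: probability_setT.
  by rewrite integral_cst// mul1e.
have ie : kappa.-integrable setT (e z).
  apply/integrableP; split => //.
  under eq_integral => y _ do rewrite gee0_abs ?evidence_ge0//.
  by rewrite e1 ltry.
have := integrable_ae measurableT ie.
by apply: filterS => y /(_ Logic.I); rewrite fin_numElt => /andP[].
Qed.

Let measurable_e : measurable_fun setT (fun p : Obs * 'rV[R]_m => e p.1 p.2).
Proof.
have mK : kernel_map (fun p : Obs * 'rV[R]_m => k p.1).
  exact: kernel_map_comp measurable_fst mk.
pose L (q : (Obs * 'rV[R]_m) * 'rV[R]_n) := (lik mdl t.+1 q.1.2 q.2)%:E.
have mL : measurable_fun setT L.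
  apply/measurable_EFinP; exact: (measurableT_comp (measurable_lik mdl t.+1)
    (measurable_fun_pair (measurableT_comp measurable_snd measurable_fst)
      measurable_snd)).
apply: (measurable_integral_predict mdl t.+1 mK mL) => q.
by rewrite lee_fin lik_ge0.
Qed.

(** The evidence is the conditional density of the new observation. *)
Let observation_formula (H : Obs * 'rV[R]_m -> \bar R) :
  measurable_fun setT H -> (forall p, 0 <= H p) ->
  \int[P]_o H (Z o, Y t.+1 o) =
  \int[P]_o \int[kappa]_y (e (Z o) y * H (Z o, y)).
Proof.
move=> mH H0.
pose F (q : Obs * ('rV[R]_n * 'rV[R]_m)) := H (q.1, q.2.2).
have mF : measurable_fun setT F.
  exact: (measurableT_comp mH (measurable_fun_pair measurable_fst
    (measurableT_comp measurable_snd measurable_snd))).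
rewrite -[LHS]/(\int[P]_o F (Z o, (X t.+1 o, Y t.+1 o))) step_formula//;
  last by move=> p; exact: H0.
apply: eq_integral => o _; apply: eq_integral => y _.
rewrite /F/= ge0_integralZr//.
- by apply/measurable_EFinP; exact: measurable_lik_x.
- by move=> x _; rewrite lee_fin lik_ge0.
Qed.

(** An observation falls with probability [0] where its own density vanishes or
    is infinite. *)
Let ae_evidence :
  {ae P, forall o, 0 < e (Z o) (Y t.+1 o) < +oo}.
Proof.
pose bad : set (Obs * 'rV[R]_m) :=
  (fun p => e p.1 p.2) @^-1` ([set 0] `|` [set +oo]).
have mbad : measurable bad.
  rewrite -[X in measurable X]setTI; apply: measurable_e => //.
  exact: measurableU.
pose H (q : Obs * 'rV[R]_m) := (\1_bad q)%:E : \bar R.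
have mH : measurable_fun setT H by exact/measurable_EFinP.
have H0 q : 0 <= H q by rewrite lee_fin.
have mZY : measurable_fun setT (fun o => (Z o, Y t.+1 o)).
  by apply: measurable_fun_pair; [exact: measurable_obs|exact: measurable_funPT].
have mbadO : measurable ((fun o => (Z o, Y t.+1 o)) @^-1` bad).
  by rewrite -[X in measurable X]setTI; exact: mZY.
have bad0 : P ((fun o => (Z o, Y t.+1 o)) @^-1` bad) = 0.
  rewrite -[X in P X]setIT -integral_indic//.
  rewrite -[LHS]/(\int[P]_o H (Z o, Y t.+1 o)) (observation_formula mH H0).
  rewrite integral0_eq// => o _.
  rewrite (ae_eq_integral (cst 0))//; first exact: integral0.
    apply: emeasurable_funM; first exact: (measurableT_comp measurable_e (measurable_pair1 _)).
    exact: (measurableT_comp mH (measurable_pair1 _)).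
  have := ae_evidence_lty (Z o); apply: filterS => y ey _.
  have [->|e0] := eqVneq (e (Z o) y) 0; first by rewrite mul0e.
  rewrite /H indicE memNset ?mule0// => -[/eqP|]; first by rewrite (negPf e0).
  by move=> eoo; move: ey; rewrite eoo ltxx.
exists ((fun o => (Z o, Y t.+1 o)) @^-1` bad); split => // o /=.
apply: contra_notP => /not_orP[e0 ey].
by rewrite lt_def evidence_ge0 andbT ltey; apply/andP; split; apply/eqP.
Qed.

Let update (z : l.+1.-tuple 'rV[R]_m) :=
  filter_step mdl t.+1 (thead z) (k [tuple of behead z]).

Let update_cons y (z : Obs) :
  update [tuple of y :: z] = filter_step mdl t.+1 y (k z).
Proof. by rewrite /update theadE; congr (filter_step _ _ _ (k _)); exact: val_inj. Qed.

Let kernel_map_update : kernel_map update.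
Proof.
apply: (kernel_map_comp (f := fun z : l.+1.-tuple 'rV[R]_m =>
  (thead z, [tuple of behead z])) _ (kernel_map_filter_step mdl t.+1 mk)).
by apply: measurable_fun_pair; [exact: measurable_tnth|exact: measurable_behead].
Qed.

(** Prediction and Bayes' rule turn a version at time [t] into one at time
    [t.+1]: by [observation_formula] an integral against the new observation
    carries the evidence as a weight, and this weight times the normalized law
    is the unnormalized one of [step_formula]. The normalization is meaningful
    almost surely. *)
Lemma filter_step_version rho : (forall o, rho o = k (Z o)) ->
  filter_version t.+1 l.+1 (fun o => filter_step mdl t.+1 (Y t.+1 o) (rho o)) /\
  {ae P, forall o,
    0 < evidence mdl t.+1 (Y t.+1 o) (predict mdl t.+1 (rho o)) < +oo}.
Proof.
move=> rhoE; split; last first.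
  by apply: filterS ae_evidence => o; rewrite rhoE.
exists update; split => //; first by move=> o; rewrite obs_cons update_cons rhoE.
move=> F mF F0.
have mcons : measurable_fun setT
    (fun p : Obs * 'rV[R]_m => [tuple of p.2 :: p.1] : l.+1.-tuple 'rV[R]_m).
  exact: (measurable_cons measurable_snd measurable_fst).
pose F1 := prepend F.
have mF1 : measurable_fun setT F1 by exact: measurable_prepend.
pose H (p : Obs * 'rV[R]_m) :=
  \int[filter_step mdl t.+1 p.2 (k p.1)]_x F ([tuple of p.2 :: p.1], x).
have mH : measurable_fun setT H.
  have mK : kernel_map (fun p : Obs * 'rV[R]_m => filter_step mdl t.+1 p.2 (k p.1)).
    exact: (kernel_map_comp (measurable_fun_pair measurable_snd measurable_fst)
      (kernel_map_filter_step mdl t.+1 mk)).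
  pose FF (q : (Obs * 'rV[R]_m) * 'rV[R]_n) := F ([tuple of q.1.2 :: q.1.1], q.2).
  have mFF : measurable_fun setT FF.
    exact: (measurableT_comp mF (measurable_fun_pair
      (measurableT_comp mcons measurable_fst) measurable_snd)).
  by apply: (measurable_kernel_integral mK _ mFF) => q; exact: F0.
have H0 p : 0 <= H p by exact: integral_ge0.
transitivity (\int[P]_o F1 (Z o, (X t.+1 o, Y t.+1 o))).
  by apply: eq_integral => o _; rewrite obs_cons.
transitivity (\int[P]_o H (Z o, Y t.+1 o)); last first.
  by apply: eq_integral => o _; rewrite obs_cons update_cons.
have F10 q : 0 <= F1 q by exact: F0.
rewrite (step_formula mF1 F10) (observation_formula mH H0).
apply: eq_integral => o _.
have mlikF : measurable_fun setT (fun y =>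
    \int[predict mdl t.+1 (k (Z o))]_x ((lik mdl t.+1 y x)%:E * F1 (Z o, (x, y)))).
  apply: (measurable_fun_fubini_tonelli_G (m1 := predict mdl t.+1 (k (Z o)))
    (fun p : 'rV[R]_n * 'rV[R]_m => (lik mdl t.+1 p.2 p.1)%:E * F1 (Z o, p))).
    exact: (measurableT_comp (measurable_lik_mul mdl t mF1) (measurable_pair1 (Z o))).
  by move=> p; rewrite mule_ge0// ?lee_fin ?lik_ge0//; exact: F0.
apply: ge0_ae_eq_integral => //.
- apply: emeasurable_funM.
    exact: (measurableT_comp measurable_e (measurable_pair1 _)).
  exact: (measurableT_comp mH (measurable_pair1 _)).
- by move=> y _; apply: integral_ge0 => x _; rewrite mule_ge0// lee_fin lik_ge0.
- by move=> y _; rewrite mule_ge0// evidence_ge0.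
have := ae_evidence_lty (Z o); apply: filterS => y ey _.
rewrite /H/= integral_bayes//.
exact: (measurableT_comp mF (measurable_pair1 _)).
Qed.

End step.
End filter_version.

Section filter_iterates.
Context d (Omega : measurableType d) {R : realType} (P : probability Omega R)
  {n m : nat} {kappa : {sigma_finite_measure set 'rV[R]_m -> \bar R}}.
Variables (X : nat -> {RV P >-> 'rV[R]_n}) (Y : nat -> {RV P >-> 'rV[R]_m}).
Variables (mdl : ssm n kappa) (mu0 : probability 'rV[R]_n R).
Hypothesis XY_gen : forall N, generated_by X Y mdl mu0 N.

Let obs_seq o k := Y k o.

Lemma filter_iter_version s j rho : (j <= s)%N -> filter_version X Y s j rho ->
  forall k, filter_version X Y (s + k) (k + j)
    (fun o => filter_iter mdl (obs_seq o) s k (rho o)).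
Proof.
move=> js rhoV; elim=> [|k IH]; first by rewrite addn0.
have [K [mK KE Kcond]] := IH.
have ksk : (k + j <= s + k)%N by rewrite addnC leq_add2r.
have [V _] := filter_step_version (XY_gen (s + k).+1) (ltnSn _) ksk mK Kcond KE.
by rewrite addnS addSn /=; under eq_fun do rewrite addnS.
Qed.

Lemma filter_defined_ae s j rho : (j <= s)%N -> filter_version X Y s j rho ->
  forall t, {ae P, forall o, filter_defined mdl (obs_seq o) s t (rho o)}.
Proof.
move=> js rhoV t; apply: ae_foralln => k.
have [sk|] := leqP s k; last first.
  by move=> _; exact: aeW.
have := filter_iter_version js rhoV (k - s); rewrite subnKC// => -[K [mK KE Kcond]].
have ksk : (k - s + j <= k)%N by rewrite -leq_subRL ?leq_subr// subKn.
have [_] := filter_step_version (XY_gen k.+1) (ltnSn _) ksk mK Kcond KE.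
by apply: filterS => o; rewrite /obs_seq => h _.
Qed.

End filter_iterates.

Section version_test.
Context d (Omega : measurableType d) {R : realType} (P : probability Omega R)
  {n m : nat}.
Variables (X : nat -> {RV P >-> 'rV[R]_n}) (Y : nat -> {RV P >-> 'rV[R]_m}).
Variables (t l : nat) (k : l.-tuple 'rV[R]_m -> probability 'rV[R]_n R).
Local Open Scope ereal_scope.
Hypotheses (mk : kernel_map k)
  (k_cond : forall F : l.-tuple 'rV[R]_m * 'rV[R]_n -> \bar R,
    measurable_fun setT F -> (forall p, 0 <= F p) ->
    \int[P]_o F (obs Y t l o, X t o) =
    \int[P]_o \int[k (obs Y t l o)]_x F (obs Y t l o, x)).
Variable g : 'rV[R]_n -> R.
Hypotheses (mg : measurable_fun setT g) (g_le1 : forall x, (`|g x| <= 1)%R).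

Lemma measurable_kernel_mean : measurable_fun setT (fun z => \int[k z]_x g x)%R.
Proof.
apply: (measurable_kernel_Rintegral (f := fun p => g p.2) (M := 1%R) mk) => //.
exact: measurableT_comp mg measurable_snd.
Qed.

(** The disintegration of a version holds for nonnegative functions; adding a
    constant extends it to bounded products. *)
Lemma version_test (c : l.-tuple 'rV[R]_m -> R) (K : R) :
  measurable_fun setT c -> (forall z, (`|c z| <= K)%R) ->
  \int[P]_o (c (obs Y t l o) * g (X t o))%:E =
  \int[P]_o (c (obs Y t l o) * \int[k (obs Y t l o)]_x g x)%:E.
Proof.
move=> mc cK.
have mZ := measurable_obs Y t l.
have mcZ : measurable_fun setT (fun o => c (obs Y t l o)) by exact: measurableT_comp.
have mr := measurable_kernel_mean.
have r_le z : (`|\int[k z]_x g x| <= 1)%R by exact: Rintegral_norm_le.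
have mgX : measurable_fun setT (fun o => g (X t o)).
  exact: measurableT_comp mg (measurable_funPT (X t)).
have mrZ : measurable_fun setT (fun o => \int[k (obs Y t l o)]_x g x)%R.
  exact: measurableT_comp mr mZ.
pose F (p : l.-tuple 'rV[R]_m * 'rV[R]_n) := (c p.1 * g p.2 + K)%:E.
have mF : measurable_fun setT F.
  apply/measurable_EFinP; apply: measurable_funD => //; apply: measurable_funM.
    exact: measurableT_comp mc measurable_fst.
  exact: measurableT_comp mg measurable_snd.
have F0 p : 0 <= F p.
  rewrite lee_fin; have := normrM_le (cK p.1) (g_le1 p.2).
  by rewrite ler_norml; lra.
have iKP (Q : probability _ R) : Q.-integrable setT (EFin \o (fun=> K)).
  by apply: (@bounded_integrable _ _ _ Q _ `|K|%R).
have := k_cond mF F0.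
have icg : P.-integrable setT (EFin \o (fun o => c (obs Y t l o) * g (X t o))%R).
  apply: (@bounded_integrable _ _ _ P _ K) => [|o]; last exact: normrM_le.
  exact: measurable_funM.
have icr : P.-integrable setT
    (EFin \o (fun o => c (obs Y t l o) * \int[k (obs Y t l o)]_x g x)%R).
  apply: (@bounded_integrable _ _ _ P _ K) => [|o]; last exact: normrM_le.
  exact: measurable_funM.
rewrite /F/= (integralD_EFin measurableT icg (iKP _ _ P)).
have -> : \int[P]_o \int[k (obs Y t l o)]_x (c (obs Y t l o) * g x + K)%:E =
    \int[P]_o ((c (obs Y t l o) * \int[k (obs Y t l o)]_x g x)%R + K)%:E.
  apply: eq_integral => o _.
  set z := obs Y t l o.
  have ig : (k z).-integrable setT (EFin \o g) by exact: bounded_integrable g_le1.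
  have icgz : (k z).-integrable setT (EFin \o (fun x => c z * g x)%R).
    apply: (@bounded_integrable _ _ _ (k z) _ K) => [|x]; last exact: normrM_le.
    exact: measurable_funM.
  rewrite -(@EFin_Rintegral _ _ _ _ _ (K + `|K|)%R); last 2 first.
  - by apply: measurable_funD => //; exact: measurable_funM.
  - by move=> x; apply: (le_trans (ler_normD _ _)); rewrite lerD2r normrM_le.
  rewrite (RintegralD measurableT icgz (iKP _ _ (k z))) (RintegralZl (c z) measurableT ig).
  congr (_ + _)%:E; rewrite Rintegral_cst//.
  by apply: (etrans (congr1 (fun u => K * fine u)%R (probability_setT (k z))));
    rewrite mulr1.
rewrite (integralD_EFin measurableT icr (iKP _ _ P)).
move=> /(congr1 (fun u => u - \int[P]_x K%:E)).
by rewrite !addeK// (integrable_fin_num measurableT (iKP _ _ P)).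
Qed.

End version_test.

Section version_unique.
Context d (Omega : measurableType d) {R : realType} (P : probability Omega R)
  {n m : nat}.
Variables (X : nat -> {RV P >-> 'rV[R]_n}) (Y : nat -> {RV P >-> 'rV[R]_m}).
Local Open Scope ereal_scope.

(** Two versions give means of [g] with the same correlation with every bounded
    function of the observations; the difference of the means is such a
    function. *)
Lemma filter_version_unique t l rho rho' (g : 'rV[R]_n -> R) :
  filter_version X Y t l rho -> filter_version X Y t l rho' ->
  measurable_fun setT g -> (forall x, (`|g x| <= 1)%R) ->
  {ae P, forall o, \int[rho o]_x g x = \int[rho' o]_x g x}%R.
Proof.
move=> [k [mk kE kc]] [k' [mk' kE' kc']] mg g1.
have mr := measurable_kernel_mean mk mg g1.
have mr' := measurable_kernel_mean mk' mg g1.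
pose r z := (\int[k z]_x g x)%R; pose r' z := (\int[k' z]_x g x)%R.
pose D z := (r z - r' z)%R.
have r_le z : (`|r z| <= 1)%R by exact: Rintegral_norm_le.
have r'_le z : (`|r' z| <= 1)%R by exact: Rintegral_norm_le.
have mD : measurable_fun setT D by exact: measurable_funB.
have D_le z : (`|D z| <= 2)%R.
  by apply: (le_trans (ler_normB _ _)); have := r_le z; have := r'_le z; lra.
have mZ := measurable_obs Y t l.
have intD (s : l.-tuple _ -> R) : measurable_fun setT s -> (forall z, `|s z| <= 1)%R ->
    P.-integrable setT (EFin \o (fun o => D (obs Y t l o) * s (obs Y t l o))%R).
  move=> ms s1; apply: (@bounded_integrable _ _ _ P _ 2) => [|o]; last exact: normrM_le.
  by apply: measurable_funM; [exact: measurableT_comp mD mZ|exact: measurableT_comp ms mZ].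
have := version_test mk kc mg g1 mD D_le.
rewrite (version_test mk' kc' mg g1 mD D_le) => Drr'.
have ir := intD r mr r_le; have ir' := intD r' mr' r'_le.
have D0 : \int[P]_o (D (obs Y t l o) ^+ 2)%:E = 0.
  transitivity (\int[P]_o (D (obs Y t l o) * r (obs Y t l o))%:E -
      \int[P]_o (D (obs Y t l o) * r' (obs Y t l o))%:E).
    rewrite -integralB_EFin//; apply: eq_integral => o _.
    by rewrite -EFinB -mulrBr -expr2.
  rewrite /r' Drr' subee//; exact: (integrable_fin_num measurableT ir).
have mD2 : measurable_fun setT (fun o => (D (obs Y t l o) ^+ 2)%:E).
  apply/measurable_EFinP; apply: measurable_funX.
  exact: measurableT_comp mD mZ.
have : \int[P]_o `|(D (obs Y t l o) ^+ 2)%:E| = 0.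
  by rewrite -[RHS]D0; apply: eq_integral => o _; rewrite gee0_abs// lee_fin sqr_ge0.
move=> /(ae_eq_integral_abs _ measurableT mD2).
apply: filterS => o /(_ Logic.I) []/eqP.
by rewrite sqrf_eq0 subr_eq0 kE kE' => /eqP.
Qed.

End version_unique.

(** * The law of a window of observations *)

Section observation_law.
Context {R : realType} {n m : nat}
  {kappa : {sigma_finite_measure set 'rV[R]_m -> \bar R}}.
Variable mdl : ssm n kappa.
Local Open Scope ereal_scope.

Section one_step.
Variables (t l : nat) (F : l.+1.-tuple 'rV[R]_m * 'rV[R]_n -> \bar R).
Hypotheses (mF : measurable_fun setT F) (F0 : forall p, 0 <= F p).

Lemma integral_obs_step d (Omega : measurableType d) (P : probability Omega R)
    (X : nat -> {RV P >-> 'rV[R]_n}) (Y : nat -> {RV P >-> 'rV[R]_m}) mu0 N :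
  generated_by X Y mdl mu0 N -> (t < N)%N -> (l <= t)%N ->
  \int[P]_o F (obs Y t.+1 l.+1 o, X t.+1 o) =
  \int[P]_o next_integral mdl t (prepend F) (obs Y t l o, X t o).
Proof.
move=> XY_gen tN lt.
have F10 q : 0 <= prepend F q by exact: F0.
rewrite -(model_step XY_gen tN lt (measurable_prepend mF) F10).
by apply: eq_integral => o _; rewrite obs_cons.
Qed.

End one_step.

Section invariant.
Hypothesis mdl_invariant : forall t : nat, (0 < t)%N ->
  (forall x A, measurable A -> trans mdl t x A = trans mdl 1%N x A) /\
  (forall y x, lik mdl t y x = lik mdl 1%N y x).

Lemma next_integral_invariant d1 (E : measurableType d1) t
    (F : E * ('rV[R]_n * 'rV[R]_m) -> \bar R) :
  next_integral mdl t F = next_integral mdl 0 F.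
Proof.
have [tE lE] := mdl_invariant (ltn0Sn t).
apply/funext => p; rewrite /next_integral.
transitivity (\int[transition mdl 1 p.2]_x \int[kappa]_y
    ((lik mdl t.+1 y x)%:E * F (p.1, (x, y)))).
  by apply: eq_measure_integral => A mA _; exact: tE.
by apply: eq_integral => x _; apply: eq_integral => y _; rewrite lE.
Qed.

Section two_processes.
Variables (d d' : measure_display) (Omega : measurableType d)
  (Omega' : measurableType d') (P : probability Omega R)
  (P' : probability Omega' R).
Variables (X : nat -> {RV P >-> 'rV[R]_n}) (Y : nat -> {RV P >-> 'rV[R]_m})
  (X' : nat -> {RV P' >-> 'rV[R]_n}) (Y' : nat -> {RV P' >-> 'rV[R]_m})
  (mu mu' : probability 'rV[R]_n R) (s w : nat).
Hypotheses (XY_gen : generated_by X Y mdl mu (s + w))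
  (XY_gen' : generated_by X' Y' mdl mu' w)
  (X0E : forall A, measurable A -> P (X s @^-1` A) = P' (X' 0%N @^-1` A)).

(** A time invariant model started from a given law produces, at any time, the
    same joint law of the state and of the observations of the window. *)
Lemma window_integral k : (k <= w)%N ->
  forall F : k.-tuple 'rV[R]_m * 'rV[R]_n -> \bar R,
  measurable_fun setT F -> (forall p, 0 <= F p) ->
  \int[P]_o F (obs Y (s + k) k o, X (s + k)%N o) =
  \int[P']_o F (obs Y' k k o, X' k o).
Proof.
elim: k => [_|k IH kw] F mF F0.
  rewrite addn0.
  pose F1 x := F ([tuple], x).
  have mF1 : measurable_fun setT F1 by exact: measurableT_comp mF (measurable_pair1 _).
  transitivity (\int[P]_o F1 (X s o)).
    by apply: eq_integral => o _; rewrite (tuple0 (obs Y s 0 o)).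
  transitivity (\int[P']_o F1 (X' 0 o)); last first.
    by apply: eq_integral => o _; rewrite (tuple0 (obs Y' 0 0 o)).
  have F10 x : 0 <= F1 x by exact: F0.
  rewrite -(ge0_integral_image_law P (measurable_funPT (X s)) mF1 F10).
  rewrite -(ge0_integral_image_law P' (measurable_funPT (X' 0)) mF1 F10).
  by apply: eq_measure_integral => A mA _; exact: X0E.
have F10 q : 0 <= prepend F q by exact: F0.
rewrite addnS (integral_obs_step mF F0 XY_gen) ?ltn_add2l ?leq_addl//.
rewrite (integral_obs_step mF F0 XY_gen')//.
rewrite next_integral_invariant IH//; last 3 first.
- exact: ltnW.
- exact: measurable_next_integral (measurable_prepend mF) F10.
- by move=> p; exact: next_integral_ge0.
by rewrite [in RHS]next_integral_invariant.
Qed.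

End two_processes.

Lemma stationary_law d (Omega : measurableType d) (P : probability Omega R)
    (X : nat -> {RV P >-> 'rV[R]_n}) (Y : nat -> {RV P >-> 'rV[R]_m})
    (mu : probability 'rV[R]_n R) :
  (forall N, generated_by X Y mdl mu N) -> stationary_distribution mdl mu ->
  forall t A, measurable A -> P (X t @^-1` A) = mu A.
Proof.
move=> XY_gen mu_stat; elim=> [|t IH] A mA; first exact: (XY_gen 0%N).1.
have mu_predict : predict mdl t.+1 mu A = mu A.
  rewrite -(mu_stat A mA); apply: eq_integral => x _.
  exact: (mdl_invariant (ltn0Sn t)).1.
rewrite -mu_predict /predict.
have -> : \int[mu]_x trans mdl t.+1 x A = \int[P]_o trans mdl t.+1 (X t o) A.
  rewrite -(ge0_integral_image_law P (measurable_funPT (X t))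
    (kernel_map_transition mdl t.+1 mA))//.
  by apply: eq_measure_integral => B mB _; apply/esym; exact: IH.
pose F (q : 0.-tuple 'rV[R]_m * ('rV[R]_n * 'rV[R]_m)) := (\1_A q.2.1)%:E : \bar R.
have mF : measurable_fun setT F.
  have m1 : measurable_fun setT (\1_A : 'rV[R]_n -> R) by exact: measurable_indic.
  apply/measurable_EFinP; exact: (measurableT_comp m1
    (measurableT_comp measurable_fst measurable_snd)).
have F0 q : 0 <= F q by rewrite lee_fin.
have mXA : measurable (X t.+1 @^-1` A).
  by rewrite -[X in measurable X]setTI; exact: measurable_funPT.
transitivity (\int[P]_o F (obs Y t 0 o, (X t.+1 o, Y t.+1 o))).
  by rewrite -[in LHS](setIT (X t.+1 @^-1` A)) -integral_indic.
rewrite (model_step (XY_gen t.+1) (ltnSn t) (leq0n t) mF F0).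
apply: eq_integral => o _.
transitivity (\int[transition mdl t.+1 (X t o)]_x (\1_A x)%:E); last first.
  by rewrite integral_indic// setIT.
apply: eq_integral => x _; rewrite /F/= ge0_integralZr//.
- by rewrite lik_mass mul1e.
- by apply/measurable_EFinP; exact: measurable_lik_y.
- by move=> y _; rewrite lee_fin lik_ge0.
Qed.

End invariant.
End observation_law.

(** * The error of a learned map *)

Section integral_extras.
Context d (T : measurableType d) (R : realType) (P : probability T R).
Local Open Scope ereal_scope.

Lemma sqrte_integral_sqrD (a b : T -> R) :
  measurable_fun setT a -> measurable_fun setT b ->
  sqrte (\int[P]_x (`|a x + b x| ^+ 2)%:E) <=
  sqrte (\int[P]_x (`|a x| ^+ 2)%:E) + sqrte (\int[P]_x (`|b x| ^+ 2)%:E).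
Proof.
move=> ma mb.
have L2E (f : T -> R) :
    Lnorm P 2%:E (EFin \o f) = sqrte (\int[P]_x (`|f x| ^+ 2)%:E).
  rewrite unlock poweR12_sqrt; last by apply: integral_ge0 => x _; exact: poweR_ge0.
  congr sqrte; apply: eq_integral => x _ /=.
  by rewrite powR_mulrn.
by rewrite -!L2E; apply: minkowski_EFin => //; rewrite ler1n.
Qed.

(** Meant for the gap, whose measurability in the training data is unclear: the
    smaller function is lowered to [-oo] on the exceptional set, which turns the
    comparison into a pointwise one. *)
Lemma le_integral_ae (h G : T -> \bar R) : measurable_fun setT h ->
  {ae P, forall x, h x <= G x} -> \int[P]_x h x <= \int[P]_x G x.
Proof.
move=> mh [N [mN N0 hG]].
pose h' x := if x \in N then -oo else h x.
have mh' : measurable_fun setT h'.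
  apply: measurable_fun_ifT => //.
  apply: (measurable_fun_bool true); rewrite setTI.
  rewrite (_ : _ @^-1` _ = N)//; apply/seteqP; split => x /=.
    by move=> /set_mem.
  by move=> /mem_set.
have -> : \int[P]_x h x = \int[P]_x h' x.
  apply: ae_eq_integral => //; exists N; split => // x /=.
  by apply: contra_notP => Nx _; rewrite /h' memNset.
apply: le_integral_pointwise => x; rewrite /h'; case: ifPn => [_|Nx].
  by rewrite leNye.
by apply: contrapT => hGx; move/negP: Nx; apply; rewrite inE; exact: hG.
Qed.

End integral_extras.

Section independent_integral.
Context d d1 d2 (Omega : measurableType d) (T1 : measurableType d1)
  (T2 : measurableType d2) (R : realType) (P : probability Omega R).
Variables (U : Omega -> T1) (V : Omega -> T2).
Hypotheses (mU : measurable_fun setT U) (mV : measurable_fun setT V)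
  (UV : independent_rv P U V).
Local Open Scope ereal_scope.

Lemma integral_independent (H : T1 * T2 -> \bar R) :
  measurable_fun setT H -> (forall p, 0 <= H p) ->
  \int[P]_o H (U o, V o) = \int[P]_o \int[image_law P mV]_v H (U o, v).
Proof.
move=> mH H0.
have mK : kernel_map (fun _ : Omega => image_law P mV).
  exact: kernel_map_cst.
apply: (joint_law_kernel mU mV mK) => // A B mA mB.
have mUA : measurable (U @^-1` A) by rewrite -[X in measurable X]setTI; exact: mU.
by rewrite UV// integral_cst// muleC.
Qed.

End independent_integral.

(** [zeta] stands for the training data with the randomness of the procedure, and
    [q] for the conditional mean of [g X] given [Y]. *)
Section conditional_transport_error.
Context d (Omega : measurableType d) {R : realType} (P : probability Omega R)
  {n m w : nat}.
Context d0 (Z : measurableType d0).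
Local Notation Obs := (w.-tuple 'rV[R]_m).
Local Notation XY := ('rV[R]_n * Obs)%type.
Variables (X : Omega -> 'rV[R]_n) (Y : Omega -> Obs) (zeta : Omega -> Z).
Hypotheses (mX : measurable_fun setT X) (mY : measurable_fun setT Y)
  (mzeta : measurable_fun setT zeta) (zetaY : independent_rv P zeta Y).
Variables (nu : probability XY R) (mu : probability 'rV[R]_n R).
Hypothesis nuE : forall A, measurable A -> nu A = P [set o | A (X o, Y o)].
Variables (fhat : Z -> XY -> R) (That : Z -> XY -> 'rV[R]_n) (alpha : R).
Hypotheses (mfhat : measurable_fun setT (fun p : Z * XY => fhat p.1 p.2))
  (mThat : measurable_fun setT (fun p : Z * XY => That p.1 p.2))
  (alpha_gt0 : 0 < alpha)
  (fhat_conv : {ae P, forall o, forall y, strongly_convex alpha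
    (fun x => 2^-1 * enorm x ^+ 2 - fhat (zeta o) (x, y))}).
Variables (g : 'rV[R]_n -> R) (q : Obs -> R).
Hypotheses (gP : bounded_lipschitz g) (mq : measurable_fun setT q)
  (q_le1 : forall y, `|q y| <= 1)
  (q_cond : forall (c : Obs -> R) K, measurable_fun setT c ->
    (forall y, `|c y| <= K) ->
    (\int[P]_o (c (Y o) * g (X o))%:E = \int[P]_o (c (Y o) * q (Y o))%:E)%E).
Local Open Scope ereal_scope.

Let mXY : measurable_fun setT (fun o => (X o, Y o)).
Proof. exact: measurable_fun_pair. Qed.

Let integral_nu (F : XY -> \bar R) : \int[nu]_p F p = \int[image_law P mXY]_p F p.
Proof. by apply: eq_measure_integral => A mA _; exact: nuE. Qed.

Let r (z : Z) (y : Obs) : R := (\int[mu]_x g (That z (x, y)))%R.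

Let mg : measurable_fun setT g := measurable_bounded_lipschitz gP.

Lemma measurable_transport_mean :
  measurable_fun setT (fun p : Z * Obs => \int[mu]_x g (That p.1 (x, p.2)))%R.
Proof.
have mK : kernel_map (fun _ : Z * Obs => mu) by exact: kernel_map_cst.
pose G (p : (Z * Obs) * 'rV[R]_n) := g (That p.1.1 (p.2, p.1.2)).
have mG : measurable_fun setT G.
  apply: (measurableT_comp mg); apply: (measurableT_comp mThat
    (g := fun p : (Z * Obs) * 'rV[R]_n => (p.1.1, (p.2, p.1.2)))).
  apply: measurable_fun_pair.
    exact: (measurableT_comp measurable_fst measurable_fst).
  apply: measurable_fun_pair; first exact: measurable_snd.
  exact: (measurableT_comp measurable_snd measurable_fst).
apply: (measurable_kernel_Rintegral (M := 1%R) mK mG) => p.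
exact: gP.1.
Qed.

Let measurable_r : measurable_fun setT (fun p : Z * Obs => r p.1 p.2).
Proof. exact: measurable_transport_mean. Qed.

(** By independence the learned pair can be frozen while the observations are
    averaged; the gap of almost every frozen pair bounds its mean square error. *)
Lemma transport_error_le_gap :
  \int[P]_o (`|r (zeta o) (Y o) - q (Y o)| ^+ 2)%:E <=
  (4 / alpha)%:E *
    \int[P]_o gap (mu \x pushforward nu snd) nu (fhat (zeta o)) (That (zeta o)).
Proof.
pose H (p : Z * Obs) := (`|r p.1 p.2 - q p.2| ^+ 2)%:E.
have mH : measurable_fun setT H.
  apply/measurable_EFinP; apply: measurable_funX; apply: measurableT_comp => //.
  apply: measurable_funB => //.
  exact: measurableT_comp mq measurable_snd.
have H0 p : 0 <= H p by rewrite lee_fin exprn_ge0.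
rewrite -[leLHS]/(\int[P]_o H (zeta o, Y o)) (integral_independent mzeta mY)//.
pose h o := \int[image_law P mY]_y H (zeta o, y).
have mh : measurable_fun setT h.
  have mK : kernel_map (fun _ : Omega => image_law P mY).
    exact: kernel_map_cst.
  pose HH (p : Omega * Obs) := H (zeta p.1, p.2).
  have mHH : measurable_fun setT HH.
    apply: (measurableT_comp mH); apply: measurable_fun_pair; last exact: measurable_snd.
    exact: (measurableT_comp mzeta measurable_fst).
  by apply: (measurable_kernel_integral mK _ mHH) => p; exact: H0.
have h0 o : 0 <= h o by exact: integral_ge0.
have gap_ge : \int[P]_o ((alpha / 4)%:E * h o) <=
    \int[P]_o gap (mu \x pushforward nu snd) nu (fhat (zeta o)) (That (zeta o)).
  apply: le_integral_ae; first exact: measurable_funeM.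
  apply: filterS fhat_conv => o fo.
  have mf : measurable_fun setT (fhat (zeta o)).
    exact: (measurableT_comp mfhat (measurable_pair1 (zeta o))).
  have mT : measurable_fun setT (That (zeta o)).
    exact: (measurableT_comp mThat (measurable_pair1 (zeta o))).
  have qnu (c : Obs -> R) K : measurable_fun setT c -> (forall y, `|c y| <= K)%R ->
      \int[nu]_p (c p.2 * g p.1)%:E = \int[nu]_p (c p.2 * q p.2)%:E.
    move=> mc cK.
    have mc2 : measurable_fun setT (fun p : XY => c p.2).
      exact: measurableT_comp mc measurable_snd.
    rewrite !integral_nu.
    rewrite (bounded_integral_image_law P mXY (h := fun p => (c p.2 * g p.1)%R) (K := K)).
    - rewrite (bounded_integral_image_law P mXY (h := fun p => (c p.2 * q p.2)%R) (K := K)).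
      + exact: q_cond mc cK.
      + apply: measurable_funM => //; exact: measurableT_comp mq measurable_snd.
      + by move=> p; exact: normrM_le.
    - apply: measurable_funM => //; exact: measurableT_comp mg measurable_fst.
    - by move=> p; apply: normrM_le => //; exact: gP.1.
  have := gap_ge_mean_square mu alpha_gt0 mf mT fo gP mq q_le1 qnu.
  apply: le_trans; rewrite le_eqVlt; apply/orP; left; apply/eqP; congr (_ * _).
  rewrite integral_nu ge0_integral_image_law.
  - rewrite /h ge0_integral_image_law//.
      by apply: eq_integral => o' _; rewrite /H/= real_normK ?num_real// -sqrrN opprB.
    exact: (measurableT_comp mH (measurable_pair1 (zeta o))).
  - apply/measurable_EFinP; apply: measurable_funX; apply: measurable_funB.
      exact: measurableT_comp mq measurable_snd.
    exact: (measurableT_comp measurable_r (measurable_fun_pair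
      (measurable_cst (zeta o)) measurable_snd)).
  - by move=> p; rewrite lee_fin sqr_ge0.
have a4 : 0 <= (4 / alpha)%:E by rewrite lee_fin divr_ge0// ltW.
have := lee_wpmul2l a4 gap_ge; apply: le_trans.
rewrite ge0_integralZl//; last by rewrite lee_fin divr_ge0// ltW.
by rewrite muleA -EFinM mulrA divfK ?gt_eqF// divff// mul1e.
Qed.

End conditional_transport_error.

(** * The error bound *)

Theorem proposition1
  (R : realType) (n m : nat)
  (kappa : {sigma_finite_measure set 'rV[R]_m -> \bar R})
  (mdl : ssm n kappa)
  (d : measure_display) (Omega : measurableType d) (P : probability Omega R)
  (X : nat -> {RV P >-> 'rV[R]_n}) (Y : nat -> {RV P >-> 'rV[R]_m})
  (pi0 : probability 'rV[R]_n R)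
  (hXY : forall N : nat, generated_by X Y mdl pi0 N)
  (pi : forall t : nat, t.-tuple 'rV[R]_m -> probability 'rV[R]_n R)
  (hpi : forall t : nat, posterior X Y (pi t))
  (w : nat) (hw : (0 < w)%N)
  (mu : probability 'rV[R]_n R)
  (nu : probability ('rV[R]_n * w.-tuple 'rV[R]_m)%type R)
  (hnu : window_law mdl mu nu)
  (J : nat)
  (Xtr : 'I_J -> nat -> {RV P >-> 'rV[R]_n})
  (Ytr : 'I_J -> nat -> {RV P >-> 'rV[R]_m})
  (htr : forall j : 'I_J, generated_by (Xtr j) (Ytr j) mdl mu w)
  (htr_indep :
    mutually_independent_rv P (fun j : 'I_J => history (Xtr j) (Ytr j) w))
  (dU : measure_display) (U : measurableType dU) (u : {RV P >-> U})
  (hindep : forall t : nat,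
    independent_rv P (fun o => (training_data Xtr Ytr w o, u o)) (history X Y t))
  (fhat : J.-tuple (w.+1.-tuple 'rV[R]_n * w.-tuple 'rV[R]_m) * U ->
          'rV[R]_n * w.-tuple 'rV[R]_m -> R)
  (hfhat : measurable_fun setT
    (fun z : (J.-tuple (w.+1.-tuple 'rV[R]_n * w.-tuple 'rV[R]_m) * U) *
             ('rV[R]_n * w.-tuple 'rV[R]_m) => fhat z.1 z.2))
  (That : J.-tuple (w.+1.-tuple 'rV[R]_n * w.-tuple 'rV[R]_m) * U ->
          'rV[R]_n * w.-tuple 'rV[R]_m -> 'rV[R]_n)
  (hThat : measurable_fun setT
    (fun z : (J.-tuple (w.+1.-tuple 'rV[R]_n * w.-tuple 'rV[R]_m) * U) *
             ('rV[R]_n * w.-tuple 'rV[R]_m) => That z.1 z.2))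
  (h1_process : stationary_process X Y)
  (h1_invariant : forall t : nat, (0 < t)%N ->
    (forall x A, measurable A -> trans mdl t x A = trans mdl 1%N x A) /\
    (forall y x, lik mdl t y x = lik mdl 1%N y x))
  (h1_pi0 : stationary_distribution mdl pi0)
  (h1_unique : forall rho : probability 'rV[R]_n R,
    stationary_distribution mdl rho ->
    forall A, measurable A -> rho A = pi0 A)
  (h1_moment : (\int[pi0]_x (enorm x ^+ 2)%:E < +oo)%E)
  (h1_density : exists p : 'rV[R]_n -> R,
    measurable_fun setT p /\ (forall x, 0 <= p x) /\
    forall A, measurable A ->
      pi0 A = (\int[lebesgue_rV n]_(x in A) (p x)%:E)%E)
  (lambda C : R) (hlambda : 0 < lambda < 1) (hC : 0 < C)
  (h2 : forall rho rho' : Omega -> probability 'rV[R]_n R,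
    random_probability rho -> random_probability rho' ->
    forall s t : nat, (s < t)%N ->
    {ae P, forall o, filter_defined mdl (fun k => Y k o) s t (rho o)} ->
    {ae P, forall o, filter_defined mdl (fun k => Y k o) s t (rho' o)} ->
    (metric P
       (fun o => filter_from_to mdl (fun k => Y k o) s t (rho o))
       (fun o => filter_from_to mdl (fun k => Y k o) s t (rho' o))
     <= (C * lambda ^+ (t - s))%:E *
        metric P (fun o => rho o) (fun o => rho' o))%E)
  (h3a : forall A, measurable A -> mu A = pi0 A)
  (M : R) (hM : 0 < M)
  (h3b : forall t : nat,
    (metric P (fun o => pi t (obs Y t t o)) (fun=> mu) < M%:E)%E)
  (alpha : R) (halpha : 0 < alpha)
  (h3c : {ae P, forall o, forall y : w.-tuple 'rV[R]_m,
    strongly_convex alpha (fun x : 'rV[R]_n =>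
      2^-1 * enorm x ^+ 2 -
      fhat (training_data Xtr Ytr w o, u o) (x, y))}) :
  forall t : nat, (w < t)%N ->
    (metric P
       (fun o => pushforward mu (fun x : 'rV[R]_n =>
          That (training_data Xtr Ytr w o, u o) (x, obs Y t w o)))
       (fun o => pi t (obs Y t t o))
     <= (C * lambda ^+ w * M)%:E +
        sqrte ((4 / alpha)%:E *
          \int[P]_o gap (mu \x pushforward nu snd) nu
            (fhat (training_data Xtr Ytr w o, u o))
            (That (training_data Xtr Ytr w o, u o))))%E.
Proof.
move=> t wt.
have tE : t = (t - w + w)%N by rewrite subnK// ltnW.
pose s := (t - w)%N.
have st : (s < t)%N by rewrite /s ltn_subrL hw (ltn_trans hw wt).
pose yseq o k := Y k o.
pose zeta o := (training_data Xtr Ytr w o, u o).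
have inv := h1_invariant.
have XsE A : measurable A -> P (X s @^-1` A) = mu A.
  by move=> mA; rewrite (stationary_law inv hXY h1_pi0)// h3a.
have mu_version := prior_version Y XsE.
have pi_version t' := posterior_version (hpi t').
(* the filter restarted from [mu] at time [s], through which both errors are
   measured *)
have [k [mk kE kc]] :
    filter_version X Y t w (fun o => filter_iter mdl (yseq o) s w mu).
  have := filter_iter_version hXY (leq0n s) mu_version w.
  by rewrite addn0 -tE.
have pis_version : filter_version X Y t t
    (fun o => filter_iter mdl (yseq o) s w (pi s (obs Y s s o))).
  have := filter_iter_version hXY (leqnn s) (pi_version s) w.
  by rewrite -tE addnC -tE.
apply: ge_ereal_sup => _ [g gP <-].
have mg := measurable_bounded_lipschitz gP.
have g1 := gP.1.
pose q y : R := \int[k y]_x g x.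
have mq : measurable_fun setT q by have H := measurable_kernel_mean mk mg g1; exact H.
have q1 y : `|q y| <= 1 by exact: Rintegral_norm_le.
have mY : measurable_fun setT (obs Y t w) by exact: measurable_obs.
have mzeta : measurable_fun setT zeta.
  apply: measurable_fun_pair; last exact: measurable_funPT.
  apply/measurable_fun_tnthP => j.
  rewrite (_ : _ \o _ = history (Xtr j) (Ytr j) w); first exact: measurable_history.
  by apply/funext => o /=; rewrite tnth_mktuple.
have zetaY : independent_rv P zeta (obs Y t w).
  move=> A B mA mB.
  have [G mG ->] := obs_history X Y (ltnW wt) mB.
  exact: hindep.
have nuE A : measurable A -> nu A = P [set o | A (X t o, obs Y t w o)].
  have [dw [Omegaw [Pw [Xw [Yw [genw nuP]]]]]] := hnu.
  move=> mA; rewrite nuP//.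
  have X0E B : measurable B -> P (X s @^-1` B) = Pw (Xw 0%N @^-1` B).
    by move=> mB; rewrite XsE// genw.1.
  pose F (z : w.-tuple 'rV[R]_m * 'rV[R]_n) : \bar R := (\1_A (z.2, z.1))%:E.
  have mF : measurable_fun setT F.
    have m1 : measurable_fun setT (\1_A : ('rV[R]_n * w.-tuple 'rV[R]_m) -> R).
      exact: measurable_indic.
    apply/measurable_EFinP; exact: (measurableT_comp m1
      (measurable_fun_pair measurable_snd measurable_fst)).
  have F0 z : (0 <= F z)%E by rewrite lee_fin.
  have := window_integral inv (hXY (s + w)%N) genw X0E (leqnn w) mF F0.
  rewrite -tE.
  have indicE' d1 (O1 : measurableType d1) (Q : probability O1 R)
      (X1 : O1 -> 'rV[R]_n) (Y1 : O1 -> w.-tuple 'rV[R]_m) :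
      measurable_fun setT X1 -> measurable_fun setT Y1 ->
      (\int[Q]_o F (Y1 o, X1 o) = Q [set o | A (X1 o, Y1 o)])%E.
    move=> mX1 mY1.
    have mXY1 := measurable_fun_pair mX1 mY1.
    have := ge0_integral_image_law Q mXY1 (h := fun v => (\1_A v)%:E).
    rewrite integral_indic// setIT => H; apply/esym/H.
      by apply/measurable_EFinP; exact: measurable_indic.
    by move=> y; rewrite lee_fin.
  rewrite !indicE'//; last exact: measurable_obs.
pose r o : R := \int[mu]_x g (That (zeta o) (x, obs Y t w o)).
pose p o : R := \int[pi t (obs Y t t o)]_x g x.
pose p' o : R := \int[filter_iter mdl (yseq o) s w (pi s (obs Y s s o))]_x g x.
have pp' : {ae P, forall o, p o = p' o}.
  exact: (filter_version_unique (pi_version t) pis_version mg g1).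
have pushE o : fine (\int[pushforward mu (fun x => That (zeta o) (x, obs Y t w o))]_x
    (g x)%:E)%E = r o.
  have mTo : measurable_fun setT (fun x => That (zeta o) (x, obs Y t w o)).
    exact: (measurableT_comp hThat (measurable_fun_pair
      (measurable_cst (zeta o)) (measurable_pair2 (obs Y t w o)))).
  exact: (congr1 fine (bounded_integral_image_law mu mTo mg g1)).
have err1 : (\int[P]_o (`|r o - q (obs Y t w o)| ^+ 2)%:E <=
    (4 / alpha)%:E * \int[P]_o gap (mu \x pushforward nu snd) nu
      (fhat (zeta o)) (That (zeta o)))%E.
  apply: (transport_error_le_gap (X := X t) (q := q) _ mY mzeta zetaY mu nuE
    hfhat hThat halpha h3c gP mq q1); first exact: measurable_funPT.
  move=> c K mc cK; exact: (version_test mk kc mg g1 mc cK).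
have [kp [mkp kpE _]] := pi_version t.
have mp : measurable_fun setT p.
  rewrite (_ : p = fun o => \int[kp (obs Y t t o)]_x g x); last first.
    by apply/funext => o; rewrite -kpE.
  exact: measurableT_comp (measurable_kernel_mean mkp mg g1) (measurable_obs Y t t).
have [kp' [mkp' kpE' _]] := pis_version.
have mp' : measurable_fun setT p'.
  rewrite (_ : p' = fun o => \int[kp' (obs Y t t o)]_x g x); last first.
    by apply/funext => o; rewrite -kpE'.
  exact: measurableT_comp (measurable_kernel_mean mkp' mg g1) (measurable_obs Y t t).
have mqo : measurable_fun setT (fun o => q (obs Y t w o)).
  exact: measurableT_comp mq mY.
have mr : measurable_fun setT r.
  exact: (measurableT_comp (measurable_transport_mean mu hThat gP)
    (measurable_fun_pair mzeta mY)).
have err2 : (sqrte (\int[P]_o (`|q (obs Y t w o) - p o| ^+ 2)%:E) <=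
    (C * lambda ^+ w * M)%:E)%E.
  have tsw : (t - s = w)%N by rewrite /s subKn// ltnW.
  have := h2 _ _ (filter_version_random (pi_version s))
    (filter_version_random mu_version) s t st
    (filter_defined_ae hXY (leqnn s) (pi_version s) t)
    (filter_defined_ae hXY (leq0n s) mu_version t).
  rewrite tsw => stab.
  apply: (@le_trans _ _ ((C * lambda ^+ w)%:E *
    metric P (fun o => pi s (obs Y s s o)) (fun=> mu))%E); last first.
    have [l0 _] := andP hlambda.
    rewrite [leRHS]EFinM; apply: lee_wpmul2l; last exact/ltW/h3b.
    by rewrite lee_fin mulr_ge0 ?exprn_ge0// ltW.
  apply: le_trans stab; apply: ereal_sup_ubound; exists g => //.
  congr sqrte.
  transitivity (\int[P]_o (`|p' o - q (obs Y t w o)| ^+ 2)%:E)%E.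
    apply: eq_integral => o _; rewrite /filter_from_to tsw.
    by rewrite /p' /q -kE.
  apply: ae_eq_integral => //.
  - apply/measurable_EFinP; apply: measurable_funX; apply: measurableT_comp => //.
    exact: measurable_funB.
  - apply/measurable_EFinP; apply: measurable_funX; apply: measurableT_comp => //.
    exact: measurable_funB.
  by apply: filterS pp' => o -> _; rewrite distrC.
have pE o : fine (\int[pi t (obs Y t t o)]_x (g x)%:E)%E = p o by [].
under eq_integral => o _ do rewrite pushE pE -(subrKA (q (obs Y t w o))).
apply: le_trans (sqrte_integral_sqrD P _ _) _.
- exact: measurable_funB.
- exact: measurable_funB.
rewrite addeC; apply: leeD => //.
rewrite lee_sqrt//; apply: le_trans err1.
by apply: integral_ge0 => o _; rewrite lee_fin exprn_ge0.
Qed.
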